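(* Let $(M,g)$ be a smooth nonempty $n$-dimensional Riemannian manifold ($n\ge2$) of positive constant sectional curvature $c$, and let $A>0$ be a real constant. Let $G$ and $J$ be the Kähler metric and complex structure on the tube $T^*_{0A}M=\{p\in T^*M:\ 0<\|p\|^2<\frac{4c}{A^2}\}$ described in the context. Then the Kähler manifold $(T^*_{0A}M,G,J)$ does not have constant holomorphic sectional curvature.
   Context: Everything is of class $C^\infty$; indices run over $1,\dots,n$ and repeated indices are summed. $\pi:T^*M\to M$ is the cotangent bundle. A local chart $(U,x^1,\dots,x^n)$ on $M$ induces the chart $(\pi^{-1}(U),q^1,\dots,q^n,p_1,\dots,p_n)$ on $T^*M$, where $q^i=x^i\circ\pi$ and $p=p_i\,dx^i_{\pi(p)}$. Let $g_{ij}$ be the components of $g$, $(g^{ij})$ the inverse matrix, $\Gamma^k_{ij}$ the Christoffel symbols of the Levi-Civita connection of $g$, $g^{0i}=p_hg^{hi}$, $\Gamma^0_{ij}=p_k\Gamma^k_{ij}$, $\|p\|^2=g^{ik}p_ip_k$, $t=\frac12\|p\|^2$. Set $$\frac{\delta}{\delta q^i}=\frac{\partial}{\partial q^i}+\Gamma^0_{ih}\frac{\partial}{\partial p_h},\qquad Dp_i=dp_i-\Gamma^0_{ij}dq^j ;$$ the fields $\frac{\delta}{\delta q^i},\frac{\partial}{\partial p_i}$ form a local frame, with dual coframe $dq^i,Dp_i$. On $T^*_{0A}M$ put $$G_{ij}=At\,g_{ij}+\frac{c-A^2t}{At}p_ip_j,\qquad H^{ij}=\frac{1}{At}g^{ij}-\frac{c-A^2t}{At^2(2c-A^2t)}g^{0i}g^{0j};$$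 these matrices are positive definite and inverse to each other. The metric is $G=G_{ij}dq^idq^j+H^{ij}Dp_iDp_j$, i.e. $G(\frac{\delta}{\delta q^i},\frac{\delta}{\delta q^j})=G_{ij}$, $G(\frac{\partial}{\partial p_i},\frac{\partial}{\partial p_j})=H^{ij}$, $G(\frac{\partial}{\partial p_i},\frac{\delta}{\delta q^j})=0$, and $$J\frac{\delta}{\delta q^i}=G_{ik}\frac{\partial}{\partial p_k},\qquad J\frac{\partial}{\partial p_i}=-H^{ik}\frac{\delta}{\delta q^k}.$$ *)

(* Defs.v *)
From HB Require Import structures.
From mathcomp Require Import all_boot all_order all_algebra.
From mathcomp Require Import all_classical all_reals all_analysis.

Set Implicit Arguments.
Unset Strict Implicit.
Unset Printing Implicit Defensive.

Import Order.TTheory GRing.Theory Num.Theory.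
Import numFieldNormedType.Exports.

Local Open Scope classical_set_scope.
Local Open Scope ring_scope.

(* Points of R^n, tangent vectors and covectors in a chart are row vectors. An
   endomorphism L of a tangent space is represented by the matrix whose rows
   are the images of the basis vectors, so that L applied to u is u *m L. *)

Section Calculus.
Variables (R : realType) (n : nat).

Definition partial (i : 'I_n) (f : 'rV[R]_n -> R) (u : 'rV[R]_n) : R :=
  'D_(delta_mx 0 i) f u.

Fixpoint Ck_on (k : nat) (D : set 'rV[R]_n) (f : 'rV[R]_n -> R) : Prop :=
  (forall u, D u -> {for u, continuous f}) /\
  (if k is k'.+1 then
     forall i : 'I_n,
       (forall u, D u -> derivable f u (delta_mx 0 i)) /\
       Ck_on k' D (partial i f)
   else True).

Definition smooth_on (D : set 'rV[R]_n) (f : 'rV[R]_n -> R) : Prop :=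
  forall k, Ck_on k D f.

End Calculus.

(* The entry (i, j) is the derivative of the j-th component along the i-th
   coordinate. *)
Definition jac (R : realType) (m n : nat) (f : 'rV[R]_m -> 'rV[R]_n)
    (u : 'rV[R]_m) : 'M[R]_(m, n) :=
  \matrix_(i < m, j < n) partial i (fun v => f v 0 j) u.

(* Data of an atlas; the laws are in is_smooth_manifold. *)
Record charted (R : realType) (T : Type) (n : nat) := Charted {
  chart_index : Type;
  chart_dom : chart_index -> set T;
  chart_coord : chart_index -> T -> 'rV[R]_n
}.

Section Manifold.
Variables (R : realType) (n : nat).

Section Charted.
Variables (T : Type) (X : charted R T n).
Implicit Types i j : chart_index X.

Definition chart_range i : set 'rV[R]_n := chart_coord i @` chart_dom i.

(* The change of coordinates from chart i to chart j; on the overlap the value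
   is unique because chart_coord i is injective on chart_dom i. *)
Definition transition i j (u : 'rV[R]_n) : 'rV[R]_n :=
  xget 0 [set v | exists x, [/\ chart_dom i x, chart_dom j x,
                                chart_coord i x = u & chart_coord j x = v]].

Definition overlap i j : set 'rV[R]_n :=
  chart_coord i @` (chart_dom i `&` chart_dom j).

(* A tensor field of rank two, given by its matrix of components in each
   chart, as a function of the coordinates of that chart. *)
Definition tensor_field2 := chart_index X -> 'rV[R]_n -> 'M[R]_n.

Record is_riemannian_metric (g : tensor_field2) : Prop := {
  metric_smooth : forall i (a b : 'I_n),
    smooth_on (chart_range i) (fun u => g i u a b);
  metric_sym : forall i u, chart_range i u -> (g i u)^T = g i u;
  metric_pos : forall i u, chart_range i u ->
    forall v : 'rV[R]_n, v != 0 -> 0 < (v *m g i u *m v^T) 0 0;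
  metric_change : forall i j u, overlap i j u ->
    g i u = jac (transition i j) u *m g j (transition i j u)
              *m (jac (transition i j) u)^T
}.

End Charted.

Record is_smooth_manifold (M : topologicalType) (X : charted R M n) : Prop := {
  manifold_hausdorff : hausdorff_space M;
  manifold_second_countable : @second_countable M;
  chart_cover : forall x : M, exists i : chart_index X, chart_dom i x;
  chart_dom_open : forall i : chart_index X, open (chart_dom i);
  chart_inj : forall (i : chart_index X) (x y : M),
    chart_dom i x -> chart_dom i y -> chart_coord i x = chart_coord i y ->
    x = y;
  chart_continuous : forall (i : chart_index X) (x : M),
    chart_dom i x -> {for x, continuous (chart_coord i)};
  chart_open_map : forall (i : chart_index X) (V : set M),
    open V -> V `<=` chart_dom i -> open (chart_coord i @` V);
  transition_smooth : forall (i j : chart_index X) (b : 'I_n),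
    smooth_on (overlap i j) (fun u => transition i j u 0 b)
}.

End Manifold.

Section Curvature.
Variables (R : realType) (n : nat).

(* In this block g is the matrix of components of a metric in one chart. *)
Implicit Types (g : 'rV[R]_n -> 'M[R]_n) (u v w : 'rV[R]_n).

(* Gamma^k_ij *)
Definition christoffel g (k i j : 'I_n) u : R :=
  2^-1 * \sum_h invmx (g u) k h *
    (partial i (fun y => g y j h) u + partial j (fun y => g y i h) u
     - partial h (fun y => g y i j) u).

(* R(d_i, d_j) d_k = sum_l (riemann g l k i j) d_l, with the convention
   R(X, Y) = [nabla_X, nabla_Y] - nabla_[X, Y] *)
Definition riemann g (l k i j : 'I_n) u : R :=
  partial i (christoffel g l j k) u - partial j (christoffel g l i k) u
  + \sum_h (christoffel g l i h u * christoffel g h j k u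
            - christoffel g l j h u * christoffel g h i k u).

Definition inner g u v w : R := (v *m g u *m w^T) 0 0.

(* R(v, w) w *)
Definition curvature_op g u v w : 'rV[R]_n :=
  \row_l \sum_k \sum_i \sum_j riemann g l k i j u * v 0 i * w 0 j * w 0 k.

Definition sectional_curvature g u v w : R :=
  inner g u (curvature_op g u v w) v /
  (inner g u v v * inner g u w w - inner g u v w ^+ 2).

Variables (T : Type) (X : charted R T n).

Definition has_constant_sectional_curvature (g : tensor_field2 X) (c : R) :=
  forall (i : chart_index X) (x : T), chart_dom i x ->
  forall v w : 'rV[R]_n, row_free (col_mx v w) ->
  sectional_curvature (g i) (chart_coord i x) v w = c.

(* Constant holomorphic sectional curvature of (S, G, J). *)
Definition has_constant_holomorphic_sectional_curvature
    (S : set T) (G J : tensor_field2 X) :=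
  exists k : R, forall (i : chart_index X) (x : T), chart_dom i x -> S x ->
  forall v : 'rV[R]_n, v != 0 ->
  sectional_curvature (G i) (chart_coord i x)
    v (v *m J i (chart_coord i x)) = k.

End Curvature.

Section CotangentBundle.
Variables (R : realType) (n : nat) (T : Type) (X : charted R T n).

(* A cotangent vector at cov_base, given by its components p_1, ..., p_n in all
   charts around cov_base; the components in the remaining charts are set to 0
   so that equal covectors are equal as records. *)
Record covector := Covector {
  cov_base : T;
  cov_comp : chart_index X -> 'rV[R]_n;
  cov_change : forall i j : chart_index X,
    chart_dom i cov_base -> chart_dom j cov_base ->
    cov_comp i =
      cov_comp j *m (jac (transition i j) (chart_coord i cov_base))^T;
  cov_junk : forall i : chart_index X, ~ chart_dom i cov_base -> cov_comp i = 0
}.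

(* The induced charts (q, p) of the cotangent bundle. *)
Definition cotangent : charted R covector (n + n) :=
  @Charted R covector (n + n) (chart_index X)
    (fun i => [set p | chart_dom i (cov_base p)])
    (fun i p => row_mx (chart_coord i (cov_base p)) (cov_comp p i)).

Section LocalFormulas.
(* c and A as in the definition of the tube; g is the metric in one chart and
   z = (q, p) the induced coordinates. *)
Variables (c A : R) (g : 'rV[R]_n -> 'M[R]_n) (z : 'rV[R]_(n + n)).
Let q : 'rV[R]_n := lsubmx z.
Let p : 'rV[R]_n := rsubmx z.

Definition cov_raise (i : 'I_n) : R := \sum_h p 0 h * invmx (g q) h i.

Definition cov_sqnorm : R := \sum_i \sum_k invmx (g q) i k * p 0 i * p 0 k.

Definition energy : R := 2^-1 * cov_sqnorm.

Definition Gamma0 : 'M[R]_n :=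
  \matrix_(i, j) \sum_k p 0 k * christoffel g k i j q.

Definition G_hor : 'M[R]_n :=
  let t := energy in
  \matrix_(i, j) (A * t * g q i j
                  + (c - A ^+ 2 * t) / (A * t) * p 0 i * p 0 j).

Definition H_ver : 'M[R]_n :=
  let t := energy in
  \matrix_(i, j) ((A * t)^-1 * invmx (g q) i j
    - (c - A ^+ 2 * t) / (A * t ^+ 2 * (2 * c - A ^+ 2 * t))
      * cov_raise i * cov_raise j).

(* The rows are the adapted frame delta/delta q^i, d/dp_i in the natural frame
   d/dq^i, d/dp_i. *)
Definition adapted_frame : 'M[R]_(n + n) :=
  block_mx 1%:M Gamma0 0 1%:M.

(* The columns are the adapted coframe dq^i, Dp_i, that is, v *m adapted_coframe
   lists the components of v in the adapted frame. *)
Definition adapted_coframe : 'M[R]_(n + n) :=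
  block_mx 1%:M (- Gamma0) 0 1%:M.

(* G_ij dq^i dq^j + H^ij Dp_i Dp_j *)
Definition tube_metric_loc : 'M[R]_(n + n) :=
  adapted_coframe *m block_mx G_hor 0 0 H_ver *m adapted_coframe^T.

(* J (delta/delta q^i) = G_ik d/dp_k, J (d/dp_i) = - H^ik delta/delta q^k *)
Definition tube_complex_structure_loc : 'M[R]_(n + n) :=
  adapted_coframe *m block_mx 0 G_hor (- H_ver) 0 *m adapted_frame.

End LocalFormulas.

Variables (g : tensor_field2 X) (c A : R).

Definition tube_metric : tensor_field2 cotangent :=
  fun i => tube_metric_loc c A (g i).

Definition tube_complex_structure : tensor_field2 cotangent :=
  fun i => tube_complex_structure_loc c A (g i).

Definition tube : set covector :=
  [set p | forall i : chart_index cotangent, chart_dom i p ->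
     0 < cov_sqnorm (g i) (chart_coord i p) < 4 * c / A ^+ 2].

End CotangentBundle.

(* Main.v *)
Require Import Defs.
From HB Require Import structures.
From mathcomp Require Import all_boot all_order all_algebra.
From mathcomp Require Import all_classical all_reals all_analysis.
From mathcomp Require Import ring lra.

(** Let [v] be a vertical vector with components [b] at a point (q, p) of the
    tube and let w = J v, both extended with constant coefficients in the
    induced chart. In <R(v, w) w, v> all derivatives of the Christoffel symbols
    of g cancel, except for the combination R(., a) a with a the base component
    of w, which is known because g has constant curvature. Only derivatives of
    G_ij along the fibre remain. With s = g^{0i} b_i, V = H^ij b_i b_j and
    W = g^ij b_i b_j - s^2 / (2 t) one finds
      <R(v, w) w, v> = A / 2 * V^2 + A * s^2 * W / (t^2 (2 c - A^2 t)),
    while the squared area of (v, w) is V^2. For b = p this gives the value A / 2; for b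
    neither proportional nor orthogonal to p it gives a larger value at the same
    point. *)

Set Implicit Arguments.
Unset Strict Implicit.
Unset Printing Implicit Defensive.

Import Order.TTheory GRing.Theory Num.Theory.
Import numFieldNormedType.Exports.

Local Open Scope classical_set_scope.
Local Open Scope ring_scope.

(** * Smooth functions and their directional derivatives *)

(** Constant fields in a chart commute, so <R(v, w) w, v> is a combination of second derivatives of
    <v, v>, <v, w>, <w, w> and of the products <nabla_w w, nabla_v v> and |nabla_v w|^2. The
    obstacle is that the constant field w is horizontal only at the chosen point, so these second
    derivatives contain derivatives of the Christoffel symbols of g that are not known individually.
    They cancel among themselves and against <nabla_w w, nabla_v v>; since nabla_v v is vertical,
    nabla_w w never has to be solved for. In nabla_v w they occur exactly in the combination that is
    the curvature of g. What is left involves only p and b, hence is rational in t, s and B = g^ij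
    b_i b_j, and the closing identity is one of rational functions. Smoothness is given through
    iterated partial derivatives, so the symmetry of second derivatives and the chain rule are
    obtained from the mean value theorem on lines. The chain rule serves the cocycle law of
    Jacobians: a covector is a compatible family of components in all charts, and one has to be
    exhibited in the tube. *)

Lemma partial_eq_on (R : realType) (n : nat) (D : set 'rV[R]_n)
    (f f' : 'rV[R]_n -> R) (i : 'I_n) (u : 'rV[R]_n) :
  open D -> D u -> {in D, f =1 f'} -> partial i f u = partial i f' u.
Proof.
move=> oD Du ff'; apply: near_eq_derive.
have : nbhs u D by apply: open_nbhs_nbhs.
by apply: filterS => y Dy; apply: ff'; rewrite inE.
Qed.

Lemma derivable_eq_on (R : realType) (n : nat) (D : set 'rV[R]_n)
    (f f' : 'rV[R]_n -> R) (v u : 'rV[R]_n) :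
  open D -> D u -> {in D, f =1 f'} -> derivable f u v -> derivable f' u v.
Proof.
move=> oD Du ff'; apply: near_eq_derivable.
have : nbhs u D by apply: open_nbhs_nbhs.
by apply: filterS => y Dy; apply: ff'; rewrite inE.
Qed.

(** * Closure of smooth functions under algebraic operations *)

Section CkClosure.
Context {R : realType} {n : nat}.
Variable D : set 'rV[R]_n.
Hypothesis oD : open D.
Implicit Types (f g : 'rV[R]_n -> R) (k : nat).

Lemma Ck_on_continuous k f : Ck_on k D f ->
  forall u, D u -> {for u, continuous f}.
Proof. by case: k => [|k] []. Qed.

Lemma continuous_eq_on f g (u : 'rV[R]_n) : D u -> {in D, f =1 g} ->
  {for u, continuous f} -> {for u, continuous g}.
Proof.
move=> Du fg; rewrite /prop_for /continuous_at -(fg u) ?inE//.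
move=> cf; apply: cvg_trans cf; apply: (near_eq_cvg (F := nbhs u)); near=> y.
by rewrite fg// inE; near: y; exact: open_nbhs_nbhs.
Unshelve. all: by end_near. Qed.

(** Derivatives at a point of an open set depend only on the values on that set. This lets the
    closure lemmas replace a partial derivative by its computed formula on [D]. *)
Lemma Ck_on_eq k f g : {in D, f =1 g} -> Ck_on k D f -> Ck_on k D g.
Proof.
elim: k f g => [|k IH] f g fg [cf hf].
  by split=> // u Du; exact: (continuous_eq_on Du fg (cf u Du)).
split; first by move=> u Du; exact: (continuous_eq_on Du fg (cf u Du)).
move=> i; have [di ci] := hf i; split.
  by move=> u Du; exact: (derivable_eq_on oD Du fg (di u Du)).
apply: (IH _ _ _ ci) => u; rewrite inE => Du.
exact: (partial_eq_on i oD Du fg).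
Qed.

Lemma Ck_onW k f : Ck_on k.+1 D f -> Ck_on k D f.
Proof.
elim: k f => [|k IH] f [cf hf]; split=> // i.
have [di ci] := hf i; split=> //; exact: IH.
Qed.

Lemma Ck_on_cst k (a : R) : Ck_on k D (fun=> a).
Proof.
elim: k a => [|k IH] a; split=> //.
- by move=> u _; exact: cst_continuous.
- by move=> u _; exact: cst_continuous.
move=> i; split; first by move=> u _; exact: derivable_cst.
apply: Ck_on_eq (IH 0) => u _; rewrite /partial.
by rewrite (derive_cst (W := R : normedModType R)).
Qed.

Lemma Ck_onD k f g : Ck_on k D f -> Ck_on k D g ->
  Ck_on k D (fun u => f u + g u).
Proof.
elim: k f g => [|k IH] f g [cf hf] [cg hg]; split=> //.
- by move=> u Du; exact: (continuousD (cf u Du) (cg u Du)).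
- by move=> u Du; exact: (continuousD (cf u Du) (cg u Du)).
move=> i; have [df pf] := hf i; have [dg pg] := hg i; split.
  by move=> u Du; apply: derivableD; [exact: df|exact: dg].
apply: Ck_on_eq (IH _ _ pf pg) => u; rewrite inE => Du.
by rewrite /partial (deriveD (df u Du) (dg u Du)).
Qed.

Lemma Ck_onM k f g : Ck_on k D f -> Ck_on k D g ->
  Ck_on k D (fun u => f u * g u).
Proof.
elim: k f g => [|k IH] f g Hf Hg.
  split=> // u Du.
  exact: (continuousM (Ck_on_continuous Hf Du) (Ck_on_continuous Hg Du)).
split.
  move=> u Du.
  exact: (continuousM (Ck_on_continuous Hf Du) (Ck_on_continuous Hg Du)).
move=> i; have [df pf] := Hf.2 i; have [dg pg] := Hg.2 i; split.
  by move=> u Du; apply: derivableM; [exact: df|exact: dg].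
apply: Ck_on_eq (Ck_onD (IH _ _ (Ck_onW Hf) pg) (IH _ _ (Ck_onW Hg) pf)) => u.
by rewrite inE => Du; rewrite /partial (deriveM (df u Du) (dg u Du)).
Qed.

Lemma Ck_onN k f : Ck_on k D f -> Ck_on k D (fun u => - f u).
Proof.
move=> Hf; apply: Ck_on_eq (Ck_onM (Ck_on_cst k (-1)) Hf) => u _ /=.
by rewrite mulN1r.
Qed.

(** Since (1/f)' = - (1/f)^2 f', the derivative is of class C^k once 1/f is, which is the induction
    hypothesis. *)
Lemma Ck_onV k f : (forall u, D u -> f u != 0) -> Ck_on k D f ->
  Ck_on k D (fun u => (f u)^-1).
Proof.
move=> f0; elim: k => [|k IH] Hf.
  by split=> // u Du; exact: (continuousV (f0 u Du) (Ck_on_continuous Hf Du)).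
split.
  by move=> u Du; exact: (continuousV (f0 u Du) (Ck_on_continuous Hf Du)).
move=> i; have [df pf] := Hf.2 i; split.
  by move=> u Du; apply: derivableV; [exact: f0|exact: df].
have IHf := IH (Ck_onW Hf).
apply: Ck_on_eq (Ck_onN (Ck_onM (Ck_onM IHf IHf) pf)) => u.
rewrite inE => Du; rewrite /partial (deriveV (f0 u Du) (df u Du)).
by rewrite expr2 invfM scaleNr.
Qed.

Lemma smooth_on_eq f g : {in D, f =1 g} -> smooth_on D f -> smooth_on D g.
Proof. by move=> fg sf k; apply: Ck_on_eq (sf k). Qed.

Lemma smooth_on_cst (a : R) : smooth_on D (fun=> a).
Proof. by move=> k; exact: Ck_on_cst. Qed.

Lemma smooth_onD f g : smooth_on D f -> smooth_on D g ->
  smooth_on D (fun u => f u + g u).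
Proof. by move=> sf sg k; exact: Ck_onD. Qed.

Lemma smooth_onM f g : smooth_on D f -> smooth_on D g ->
  smooth_on D (fun u => f u * g u).
Proof. by move=> sf sg k; exact: Ck_onM. Qed.

Lemma smooth_onN f : smooth_on D f -> smooth_on D (fun u => - f u).
Proof. by move=> sf k; exact: Ck_onN. Qed.

Lemma smooth_onV f : (forall u, D u -> f u != 0) -> smooth_on D f ->
  smooth_on D (fun u => (f u)^-1).
Proof. by move=> f0 sf k; exact: Ck_onV. Qed.

Lemma smooth_on_sum (I : Type) (r : seq I) (P : pred I)
    (F : I -> 'rV[R]_n -> R) : (forall i, smooth_on D (F i)) ->
  smooth_on D (fun u => \sum_(i <- r | P i) F i u).
Proof.
move=> sF; elim: r => [|i r IH].
  apply: smooth_on_eq (smooth_on_cst 0) => u _; by rewrite big_nil.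
case: (boolP (P i)) => Pi; last first.
  by apply: smooth_on_eq IH => u _; rewrite big_cons (negbTE Pi).
by apply: smooth_on_eq (smooth_onD (sF i) IH) => u _; rewrite big_cons Pi.
Qed.

Lemma smooth_on_prod (I : Type) (r : seq I) (P : pred I)
    (F : I -> 'rV[R]_n -> R) : (forall i, smooth_on D (F i)) ->
  smooth_on D (fun u => \prod_(i <- r | P i) F i u).
Proof.
move=> sF; elim: r => [|i r IH].
  apply: smooth_on_eq (smooth_on_cst 1) => u _; by rewrite big_nil.
case: (boolP (P i)) => Pi; last first.
  by apply: smooth_on_eq IH => u _; rewrite big_cons (negbTE Pi).
by apply: smooth_on_eq (smooth_onM (sF i) IH) => u _; rewrite big_cons Pi.
Qed.

Lemma smooth_on_continuous f : smooth_on D f ->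
  forall u, D u -> {for u, continuous f}.
Proof. by move=> /(_ 0%N) /Ck_on_continuous. Qed.

Lemma smooth_on_derivable f i : smooth_on D f ->
  forall u, D u -> derivable f u (delta_mx 0 i).
Proof. by move=> /(_ 1%N) [_ /(_ i) []]. Qed.

Lemma smooth_on_partial f i : smooth_on D f -> smooth_on D (partial i f).
Proof. by move=> sf k; have [_ /(_ i) []] := sf k.+1. Qed.

End CkClosure.

Lemma smooth_on_sub (R : realType) (n : nat) (D E : set 'rV[R]_n)
    (f : 'rV[R]_n -> R) : E `<=` D -> smooth_on D f -> smooth_on E f.
Proof.
move=> ED sf k; elim: k f sf => [|k IH] f sf; split=> //.
- by move=> u /ED; exact: smooth_on_continuous.
- by move=> u /ED; exact: smooth_on_continuous.
move=> i; split; first by move=> u /ED; exact: smooth_on_derivable.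
by apply: IH; exact: smooth_on_partial.
Qed.

(** * Functions of a pair (q, p) that depend on q only *)

Section Pullback.
Context {R : realType} {n1 n2 : nat}.
Implicit Types (f : 'rV[R]_n1 -> R) (z : 'rV[R]_(n1 + n2)).

Lemma lsubmx_delta_lshift (i : 'I_n1) :
  lsubmx (delta_mx 0 (lshift n2 i) : 'rV[R]_(n1 + n2)) = delta_mx 0 i.
Proof. by apply/rowP => j; rewrite !mxE (inj_eq (@lshift_inj _ _)). Qed.

Lemma lsubmx_delta_rshift (i : 'I_n2) :
  lsubmx (delta_mx 0 (rshift n1 i) : 'rV[R]_(n1 + n2)) = 0.
Proof. by apply/rowP => j; rewrite !mxE eq_lrshift andbF. Qed.

(** Projection commutes with moving along a line, so the difference quotients coincide as functions;
    derivability and the value of the derivative transfer together. *)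
Lemma growth_lsubmx f (v z : 'rV[R]_(n1 + n2)) :
  (fun h : R => h^-1 *: (((fun y => f (lsubmx y)) \o shift z) (h *: v)
     - f (lsubmx z))) =
  (fun h : R => h^-1 *: ((f \o shift (lsubmx z)) (h *: lsubmx v)
     - f (lsubmx z))).
Proof.
apply/funext => h /=; congr (_ *: (f _ - _)).
by apply/rowP => j; rewrite !mxE.
Qed.

Lemma derivable_lsubmx f (v z : 'rV[R]_(n1 + n2)) :
  derivable f (lsubmx z) (lsubmx v) -> derivable (fun y => f (lsubmx y)) z v.
Proof. by rewrite /derivable growth_lsubmx. Qed.

Lemma derive_lsubmx f (v z : 'rV[R]_(n1 + n2)) :
  'D_v (fun y => f (lsubmx y)) z = 'D_(lsubmx v) f (lsubmx z).
Proof. by rewrite /derive growth_lsubmx. Qed.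

Lemma partial_lsubmx_lshift f (i : 'I_n1) z :
  partial (lshift n2 i) (fun y => f (lsubmx y)) z = partial i f (lsubmx z).
Proof. by rewrite /partial derive_lsubmx lsubmx_delta_lshift. Qed.

Lemma partial_lsubmx_rshift f (i : 'I_n2) z :
  partial (rshift n1 i) (fun y => f (lsubmx y)) z = 0.
Proof. by rewrite /partial derive_lsubmx lsubmx_delta_rshift derive0. Qed.

Lemma smooth_on_lsubmx (D : set 'rV[R]_n1) (E : set 'rV[R]_(n1 + n2)) f :
  open E -> (forall z, E z -> D (lsubmx z)) -> smooth_on D f ->
  smooth_on E (fun z => f (lsubmx z)).
Proof.
move=> oE ED sf k; elim: k f sf => [|k IH] f sf.
  split=> // z Ez; apply: (@continuous_comp _ _ _ (@lsubmx R 1 n1 n2) f).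
    exact/differentiable_continuous/differentiable_lsubmx.
  by apply: (smooth_on_continuous sf); exact: ED.
split.
  move=> z Ez; apply: (@continuous_comp _ _ _ (@lsubmx R 1 n1 n2) f).
    exact/differentiable_continuous/differentiable_lsubmx.
  by apply: (smooth_on_continuous sf); exact: ED.
move=> i; case: (split_ordP i) => j ->.
  split.
    move=> z Ez; apply: derivable_lsubmx; rewrite lsubmx_delta_lshift.
    by apply: (smooth_on_derivable sf); exact: ED.
  apply: (Ck_on_eq oE) (IH _ (smooth_on_partial j sf)) => z _.
  by rewrite partial_lsubmx_lshift.
split.
  move=> z Ez; apply: derivable_lsubmx; rewrite lsubmx_delta_rshift.
  exact: derivable0.
apply: (Ck_on_eq oE) (Ck_on_cst oE k 0) => z _.
by rewrite partial_lsubmx_rshift.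
Qed.

End Pullback.

(** * Coordinate functions *)

Section Coordinates.
Context {R : realType} {n : nat}.

Lemma derive_coord (v u : 'rV[R]_n) (j : 'I_n) :
  is_derive u v (fun y : 'rV[R]_n => y 0 j) (v 0 j).
Proof.
have H : (fun h : R => h^-1 *: (((fun y : 'rV[R]_n => y 0 j) \o shift u)
    (h *: v) - u 0 j)) @ 0^' --> v 0 j.
  have : (fun=> v 0 j) @ (0 : R)^' --> v 0 j by exact: cvg_cst.
  apply: cvg_trans; apply: near_eq_cvg; near=> h => /=; rewrite !mxE addrK.
  by rewrite /GRing.scale/= mulKf//; near: h; exact: nbhs_dnbhs_neq.
by split; [apply/cvg_ex; exists (v 0 j)|apply: cvg_lim].
Unshelve. all: by end_near. Qed.

Lemma partial_coord (i j : 'I_n) (u : 'rV[R]_n) :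
  partial i (fun y : 'rV[R]_n => y 0 j) u = (i == j)%:R.
Proof.
by rewrite /partial; case: (derive_coord (delta_mx 0 i) u j) => _ ->;
  rewrite mxE eqxx eq_sym.
Qed.

Lemma smooth_on_coord (D : set 'rV[R]_n) (j : 'I_n) : open D ->
  smooth_on D (fun y : 'rV[R]_n => y 0 j).
Proof.
move=> oD [|k]; split=> //.
- by move=> u _; exact: coord_continuous.
- by move=> u _; exact: coord_continuous.
move=> i; split; first by move=> u _; case: (derive_coord (delta_mx 0 i) u j).
apply: (Ck_on_eq oD) (Ck_on_cst oD k (i == j)%:R) => u _.
by rewrite partial_coord.
Qed.

End Coordinates.

(** * The mean value theorem along lines *)

Section MeanValue.
Context {R : realType} {n : nat}.
Implicit Types (f : 'rV[R]_n -> R) (u e : 'rV[R]_n).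

Lemma is_derive_line f u e (s : R) : derivable f (u + s *: e) e ->
  is_derive s (1 : R) (fun x : R => f (u + x *: e)) ('D_e f (u + s *: e)).
Proof.
have E : (fun h : R => h^-1 *: (((fun x : R => f (u + x *: e)) \o shift s)
    (h *: (1 : R)) - f (u + s *: e))) =
  (fun h : R => h^-1 *: ((f \o shift (u + s *: e)) (h *: e)
    - f (u + s *: e))).
  apply/funext => h /=; congr (_ *: (f _ - _)).
  by rewrite scalerDl addrCA /GRing.scale/= mulr1.
by move=> df; split; rewrite /derivable /derive E.
Qed.

(** The sign of [h] is free, and the intermediate point is located only by [|s| <= |h|], which is
    what the continuity arguments below use. *)
Lemma mean_value_line f u e (h : R) :
  (forall s : R, `|s| <= `|h| -> derivable f (u + s *: e) e) ->
  exists2 s : R, `|s| <= `|h| & f (u + h *: e) - f u = h * 'D_e f (u + s *: e).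
Proof.
move=> df; pose phi (x : R) := f (u + x *: e).
pose dphi (x : R) := 'D_e f (u + x *: e).
have mvt (a b : R) : a <= b -> (forall x, x \in `[a, b]%R -> `|x| <= `|h|) ->
    exists2 c, c \in `[a, b]%R & phi b - phi a = dphi c * (b - a).
  move=> ab abh.
  have dab x : x \in `[a, b]%R -> is_derive x (1 : R) phi (dphi x).
    by move=> /abh /df; exact: is_derive_line.
  have H1 x : x \in `]a, b[%R -> is_derive x (1 : R) phi (dphi x).
    by move=> /subset_itv_oo_cc; exact: dab.
  have H2 : {within `[a, b], continuous phi}.
    by apply: derivable_within_continuous => x /dab [].
  have H3 := MVT_segment ab H1 H2.
  exact: H3.
have f0 : f u = phi 0 by rewrite /phi scale0r addr0.
have [h0|h0] := leP 0 h.
  have [x|c cI e1] := mvt _ _ h0.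
    by rewrite in_itv/= => /andP[x0 xh]; rewrite !ger0_norm.
  exists c; last by rewrite f0 e1 subr0 mulrC.
  by move: cI; rewrite in_itv/= => /andP[x0 xh]; rewrite !ger0_norm.
have [x|c cI e1] := mvt _ _ (ltW h0).
  by rewrite in_itv/= => /andP[xh x0]; rewrite !ler0_norm ?lerN2// ltW.
exists c; last by rewrite f0 -opprB e1 sub0r mulrN opprK mulrC.
by move: cI; rewrite in_itv/= => /andP[xh x0]; rewrite !ler0_norm ?lerN2// ltW.
Qed.

Lemma norm_delta_mx_le1 (i : 'I_n) : `|delta_mx 0 i : 'rV[R]_n| <= 1.
Proof.
rewrite [leLHS]/Num.Def.normr/= mx_normrE; apply: bigmax_le => // -[a b] _ /=.
by rewrite mxE; case: (_ && _); rewrite ?normr1 ?normr0.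
Qed.

Lemma open_norm_ball (D : set 'rV[R]_n) u : open D -> D u ->
  exists2 r : R, 0 < r & forall y, `|y - u| < r -> D y.
Proof.
move=> oD Du; have : nbhs u D by apply: open_nbhs_nbhs.
move=> /nbhs_ballP[r /= r0 rD]; exists r => // y yu; apply: rD.
by rewrite -ball_normE/= distrC.
Qed.

End MeanValue.

(** * Symmetry of second partial derivatives *)

Section Schwarz.
Context {R : realType} {n : nat}.
Variables (D : set 'rV[R]_n) (f : 'rV[R]_n -> R).
Hypothesis oD : open D.
Hypothesis sf : smooth_on D f.

Lemma subr_swap (a b c d : R) : a - b - (c - d) = a - c - (b - d).
Proof. by ring. Qed.

(* The left-hand side is symmetric in [i] and [j]. *)
Lemma second_difference (i j : 'I_n) (u : 'rV[R]_n) (s : R) :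
  0 <= s -> (forall y, `|y - u| <= 2 * s -> D y) ->
  exists2 y : 'rV[R]_n, `|y - u| <= 2 * s &
    f (u + s *: delta_mx 0 i + s *: delta_mx 0 j) - f (u + s *: delta_mx 0 i)
      - (f (u + s *: delta_mx 0 j) - f u) =
    s ^+ 2 * partial j (partial i f) y.
Proof.
move=> s0 sD; pose d k := s *: (delta_mx 0 k : 'rV[R]_n).
have nd k (x : R) : `|x| <= s -> `|x *: (delta_mx 0 k : 'rV[R]_n)| <= s.
  move=> xs; rewrite normrZ; apply: le_trans xs.
  by rewrite ler_piMr ?norm_delta_mx_le1.
have D2 k l (x y : R) : `|x| <= s -> `|y| <= s ->
    `|u + x *: (delta_mx 0 k : 'rV[R]_n) + y *: (delta_mx 0 l : 'rV[R]_n) - u|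
      <= 2 * s.
  move=> xs ys; rewrite addrAC [u + _]addrC addrK mulr_natl mulr2n.
  by apply: le_trans (ler_normD _ _) _; apply: lerD; exact: nd.
have s00 : `|0 : R| <= s by rewrite normr0.
have ss : `|s| <= s by rewrite ger0_norm.
(* The mean value theorem is applied twice: along [i] to the increment [phi] of [f] in direction
   [j], then along [j] to [partial i f]. *)
pose phi y := f (y + d j) - f y.
have dphi (x : R) : `|x| <= s ->
    is_derive (u + x *: delta_mx 0 i) (delta_mx 0 i) phi
      (partial i f (u + x *: delta_mx 0 i + d j)
       - partial i f (u + x *: delta_mx 0 i)).
  move=> xs; apply: is_deriveB.
    have df : derivable f (u + x *: delta_mx 0 i + d j) (delta_mx 0 i).
      by apply: (smooth_on_derivable sf); apply: sD; exact: D2.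
    have E : (fun h : R => h^-1 *: (((fun y => f (y + d j)) \o
        shift (u + x *: delta_mx 0 i)) (h *: (delta_mx 0 i))
          - f (u + x *: delta_mx 0 i + d j))) =
      (fun h : R => h^-1 *: ((f \o shift (u + x *: delta_mx 0 i + d j))
        (h *: delta_mx 0 i) - f (u + x *: delta_mx 0 i + d j))).
      by apply/funext => h /=; rewrite !addrA.
    by split; rewrite /derivable /partial /derive E.
  have df : derivable f (u + x *: delta_mx 0 i) (delta_mx 0 i).
    apply: (smooth_on_derivable sf); apply: sD.
    by have := D2 i i x 0 xs s00; rewrite scale0r addr0.
  by split.
have [x|x xs e1] := @mean_value_line R n phi u (delta_mx 0 i) s.
  by rewrite (ger0_norm s0) => /dphi [].
rewrite (ger0_norm s0) in xs.
have [y ys e2] : exists2 y : R, `|y| <= s &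
    partial i f (u + x *: delta_mx 0 i + d j)
      - partial i f (u + x *: delta_mx 0 i) =
    s * partial j (partial i f) (u + x *: delta_mx 0 i + y *: delta_mx 0 j).
  have [y|y] := @mean_value_line R n (partial i f)
      (u + x *: delta_mx 0 i) (delta_mx 0 j) s.
    rewrite (ger0_norm s0) => ys.
    apply: (smooth_on_derivable (smooth_on_partial i sf)).
    by apply: sD; exact: D2.
  by rewrite (ger0_norm s0) => ys e2; exists y.
exists (u + x *: delta_mx 0 i + y *: delta_mx 0 j); first exact: D2.
rewrite expr2 -mulrA -e2.
case: (dphi x xs) => _ <-; by rewrite -e1.
Qed.

(** One and the same second difference is a multiple of a value of either mixed derivative at points
    close to [u]; if the two differed at [u], continuity would keep these values apart. *)
Lemma partialC (i j : 'I_n) u : D u ->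
  partial j (partial i f) u = partial i (partial j f) u.
Proof.
move=> Du; apply/eqP; rewrite -subr_eq0; apply/negPn/negP => ne0.
(* Half of the gap: two deviations smaller than [e] cannot bridge it. *)
have [e e0 eE] : exists2 e : R, 0 < e &
    e + e = `|partial j (partial i f) u - partial i (partial j f) u|.
  exists (`|partial j (partial i f) u - partial i (partial j f) u| / 2).
    by rewrite divr_gt0// normr_gt0.
  by rewrite -splitr.
have cont k l : exists2 r : R, 0 < r & forall y, `|y - u| < r ->
    `|partial l (partial k f) u - partial l (partial k f) y| < e.
  have := smooth_on_continuous
    (smooth_on_partial l (smooth_on_partial k sf)) Du.
  move=> /cvgrPdist_lt /(_ _ e0) /nbhs_ballP[r /= r0 H]; exists r => // y yu.
  by apply: H; rewrite -ball_normE/= distrC.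
have [r r0 rD] := open_norm_ball oD Du.
have [r1 r10 H1] := cont i j; have [r2 r20 H2] := cont j i.
(* The intermediate points lie within [2 * s] of [u], so a quarter of the smallest radius is
   enough. *)
have [s s0 sr] : exists2 s : R, 0 < s &
    forall x, Num.min r (Num.min r1 r2) <= x -> 2 * s < x.
  have : 0 < Num.min r (Num.min r1 r2) by rewrite !lt_min r0 r10.
  move: (Num.min r _) => m m0; exists (m / 4); first by rewrite divr_gt0.
  by move=> x mx; clear - m0 mx; lra.
have sD y : `|y - u| <= 2 * s -> D y.
  by move=> ys; apply: rD; apply: le_lt_trans ys (sr _ _); rewrite ge_min lexx.
have [y1 y1s e1] := second_difference i j (ltW s0) sD.
have [y2 y2s e2] := second_difference j i (ltW s0) sD.
have y1r : `|y1 - u| < r1.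
  by apply: le_lt_trans y1s (sr _ _); rewrite !ge_min lexx !orbT.
have y2r : `|y2 - u| < r2.
  by apply: le_lt_trans y2s (sr _ _); rewrite !ge_min lexx !orbT.
have E : partial j (partial i f) y1 = partial i (partial j f) y2.
  have sn0 : s ^+ 2 != 0 by rewrite expf_neq0// gt_eqF.
  have Ee : s ^+ 2 * partial j (partial i f) y1 =
            s ^+ 2 * partial i (partial j f) y2.
    apply: etrans (esym e1) (etrans _ e2).
    rewrite [u + _ + s *: delta_mx 0 i]addrAC.
    exact: subr_swap.
  exact: (mulfI sn0 Ee).
have {H1} H1 := H1 _ y1r; have {H2} H2 := H2 _ y2r.
rewrite -E in H2; move: eE; rewrite (_ : partial j _ u - _ =
  (partial j (partial i f) u - partial j (partial i f) y1)
  - (partial i (partial j f) u - partial j (partial i f) y1)); last first.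
  by rewrite opprB addrA subrK.
move=> eE; have := le_lt_trans (ler_normB _ _) (ltrD H1 H2).
by rewrite -eE ltxx.
Qed.

End Schwarz.

(** * The chain rule *)

Section ChainRule.
Context {R : realType} {n : nat}.

Lemma row_prefix_step (b : 'I_n) (x : 'rV[R]_n) :
  \row_j (if (j < b.+1)%N then x 0 j else 0) =
  \row_j (if (j < b)%N then x 0 j else 0) + x 0 b *: delta_mx 0 b.
Proof.
apply/rowP => j; rewrite !mxE eqxx /= ltnS leq_eqVlt.
have [->|jb] := eqVneq j b; first by rewrite eqxx ltnn/= mulr1 add0r.
have /negbTE -> : (j : nat) != b by apply: contra_neq jb => ?; exact: val_inj.
by rewrite mulr0 addr0.
Qed.

(* Caratheodory's form of differentiability, with one slope function per
   coordinate. *)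
Lemma smooth_on_slopes (D : set 'rV[R]_n) (f : 'rV[R]_n -> R) (u : 'rV[R]_n) :
  open D -> D u -> smooth_on D f ->
  exists F : 'I_n -> 'rV[R]_n -> R,
    (forall b, {for u, continuous (F b)} /\ F b u = partial b f u) /\
    (\forall y \near u, f y = f u + \sum_b (y 0 b - u 0 b) * F b y).
Proof.
move=> oD Du sf; have [r r0 rD] := open_norm_ball oD Du.
have addKu (x y : 'rV[R]_n) : u + x + y - u = x + y.
  by rewrite -(addrA u) addrAC subrr add0r.
(* The path from [u] to [y] changes one coordinate at a time; [pre k y] is the displacement after
   the first [k] coordinates. *)
pose pre (k : nat) (y : 'rV[R]_n) : 'rV[R]_n :=
  \row_j (if (j < k)%N then (y - u) 0 j else 0).
have npre (k : nat) y (b : 'I_n) (s : R) : k = b -> `|s| <= `|(y - u) 0 b| ->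
    `|pre k y + s *: delta_mx 0 b| <= `|y - u|.
  move=> kb sb; have le j : `|(y - u) 0 j| <= `|y - u|.
    rewrite [leRHS]/Num.Def.normr/= mx_normrE.
    exact: (le_bigmax _ (fun ij => `|(y - u) ij.1 ij.2|) (0, j)).
  rewrite [leLHS]/Num.Def.normr/= mx_normrE; apply: bigmax_le => // -[a j] _ /=.
  rewrite ord1 !mxE eqxx /= kb; have [->|jb] := eqVneq j b.
    by rewrite ltnn add0r mulr1; exact: le_trans sb (le b).
  rewrite mulr0 addr0; case: ifP => _; last by rewrite normr0.
  by have := le j; rewrite !mxE.
have step y (b : 'I_n) : exists s : R, `|s| <= `|(y - u) 0 b| /\
    (`|y - u| < r -> f (u + pre b.+1 y) - f (u + pre b y) =
      (y 0 b - u 0 b) * partial b f (u + pre b y + s *: delta_mx 0 b)).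
  have [yr|yr] := ltP (`|y - u|) r; last first.
    (* Outside the ball no mean value identity is required; the default 0 only has to satisfy the
       bound. *)
    by exists 0; rewrite normr0; split => //; rewrite ltNge yr.
  have [s sb|s sb e1] := @mean_value_line R n f (u + pre b y) (delta_mx 0 b)
      ((y - u) 0 b).
    apply: (smooth_on_derivable sf); apply: rD.
    by rewrite addKu; apply: le_lt_trans yr; exact: npre.
  exists s; split=> // _; rewrite -[partial b f _]/('D_(delta_mx 0 b) f _).
  have -> : y 0 b - u 0 b = (y - u) 0 b by rewrite !mxE.
  by rewrite -e1 /pre row_prefix_step addrA.
(* The intermediate points are chosen arbitrarily for all [y] at once. They are no farther from [u]
   than [y] is, and this alone makes the slopes continuous at [u]. *)
have [S HS] := choice (fun yb : 'rV[R]_n * 'I_n => step yb.1 yb.2).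
exists (fun b y => partial b f (u + pre b y + S (y, b) *: delta_mx 0 b)).
have Sn (b : 'I_n) y :
    `|(u + pre b y + S (y, b) *: delta_mx 0 b) - u| <= `|y - u|.
  rewrite addKu; apply: npre => //.
  by have [] := HS (y, b).
split=> [b|].
  have Eu : u + pre b u + S (u, b) *: delta_mx 0 b = u.
    apply/eqP; rewrite -subr_eq0 -normr_le0.
    by apply: le_trans (Sn b u) _; rewrite subrr normr0.
  split; last by rewrite Eu.
  rewrite /prop_for /continuous_at Eu.
  have cp := smooth_on_continuous (smooth_on_partial b sf) Du.
  have cg :
      (fun y : 'rV[R]_n => u + pre b y + S (y, b) *: delta_mx 0 b) @ u --> u.
    apply/(@cvgrPdist_lt _ _ _ (nbhs u)) => e e0.
    apply/nbhs_ballP; exists e => // y.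
    rewrite -ball_normE/= distrC => yu.
    by rewrite distrC; exact: le_lt_trans (Sn b y) yu.
  exact: (cvg_comp _ _ cg cp).
apply/nbhs_ballP; exists r => // y; rewrite -ball_normE/= distrC => yr.
have tel : f (u + pre n y) - f (u + pre 0%N y) = \sum_(b < n)
    (f (u + pre b.+1 y) - f (u + pre b y)).
  by rewrite -(big_mkord xpredT (fun k => f (u + pre k.+1 y) - f (u + pre k y)))
    telescope_sumr.
have En : u + pre n y = y.
  by apply/rowP => j; rewrite !mxE ltn_ord addrC subrK.
have E0 : u + pre 0%N y = u.
  by apply/rowP => j; rewrite !mxE addr0.
rewrite En E0 in tel; rewrite -[LHS](subrK (f u)) addrC tel; congr (_ + _).
by apply: eq_bigr => b _; have [_ ->] := HS (y, b).
Qed.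

(** With the slopes of [f], the difference quotient of the composite is a finite sum of difference
    quotients of the components of [w] times slopes, and each factor converges. *)
Lemma is_derive_chain (m : nat) (D : set 'rV[R]_n) (f : 'rV[R]_n -> R)
    (w : 'rV[R]_m -> 'rV[R]_n) (u e : 'rV[R]_m) :
  open D -> D (w u) -> smooth_on D f ->
  (forall b, derivable (fun y => w y 0 b) u e) ->
  is_derive u e (fun y => f (w y))
    (\sum_b 'D_e (fun y => w y 0 b) u * partial b f (w u)).
Proof.
move=> oD Dwu sf dw.
have [F [Fc Fe]] := smooth_on_slopes oD Dwu sf.
(* Derivability in the direction [e] gives continuity of [w] along that line only, which suffices
   for the slopes. *)
have cw : (fun h : R => w (h *: e + u)) @ (0 : R)^' --> w u.
  have : derivable (fun h : R => w (u + h *: e)) 0 (1 : R).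
    apply/derivable_mxP => i b; rewrite ord1.
    have H := dw b; have := @is_derive_line R m (fun y => w y 0 b) u e 0.
    by rewrite scale0r addr0 => /(_ H) [].
  move=> /derivable1_diffP /differentiable_continuous.
  rewrite /prop_for /continuous_at /= scale0r addr0 => H.
  have : (fun h : R => w (u + h *: e)) @ (0 : R)^' --> w u.
    exact: cvg_within_filter.
  by under eq_fun do rewrite addrC.
have lim : (fun h : R => h^-1 *: (((fun y => f (w y)) \o shift u) (h *: e)
    - f (w u))) @ (0 : R)^' -->
    \sum_b 'D_e (fun y => w y 0 b) u * partial b f (w u).
  have : (fun h : R => \sum_b (h^-1 *: (((fun y => w y 0 b) \o shift u)
      (h *: e) - w u 0 b)) * F b (w (h *: e + u))) @ (0 : R)^' -->
      \sum_b 'D_e (fun y => w y 0 b) u * partial b f (w u).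
    apply: cvg_big => [|b _]; first exact: add_continuous.
    apply: cvgM; first exact: dw.
    have [Fb <-] := Fc b; exact: (cvg_comp _ _ cw Fb).
  move=> H; apply: cvg_trans H; apply: (near_eq_cvg (F := (0 : R)^')).
  have Hn : \forall h \near (0 : R)^', f (w (h *: e + u)) = f (w u)
    + \sum_b (w (h *: e + u) 0 b - w u 0 b) * F b (w (h *: e + u)).
    exact: cw _ Fe.
  near=> h; rewrite /= (near Hn h)//.
  rewrite [f _ + _]addrC addrK scaler_sumr; apply: eq_bigr => b _.
  by rewrite /GRing.scale/= mulrA.
by split; [apply/cvg_ex; eexists; exact: lim|apply: cvg_lim].
Unshelve. all: by end_near. Qed.

End ChainRule.

(** * Directional derivatives of scalar functions *)

Definition dir (R : realType) (m : nat) (v : 'rV[R]_m) (f : 'rV[R]_m -> R)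
    (u : 'rV[R]_m) : R := \sum_i v 0 i * partial i f u.

(** Like [dir], built from partial derivatives rather than from ['D_v]: [smooth_on] speaks of
    partial derivatives, and homogeneity in [v] is then immediate. *)
Definition mdir (R : realType) (m r s : nat) (v : 'rV[R]_m)
    (F : 'rV[R]_m -> 'M[R]_(r, s)) (u : 'rV[R]_m) : 'M[R]_(r, s) :=
  \matrix_(a, b) dir v (fun y => F y a b) u.

Definition msmooth (R : realType) (m r s : nat) (D : set 'rV[R]_m)
    (F : 'rV[R]_m -> 'M[R]_(r, s)) :=
  forall a b, smooth_on D (fun u => F u a b).

Lemma eq_partial (R : realType) (m : nat) (i : 'I_m) (f h : 'rV[R]_m -> R) u :
  f =1 h -> partial i f u = partial i h u.
Proof. by move=> /funext ->. Qed.

Lemma eq_dir (R : realType) (m : nat) (v : 'rV[R]_m) (f h : 'rV[R]_m -> R) u :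
  f =1 h -> dir v f u = dir v h u.
Proof. by move=> /funext ->. Qed.

Section Directional.
Context {R : realType} {m : nat}.
Variable D : set 'rV[R]_m.
Hypothesis oD : open D.
Implicit Types (f h : 'rV[R]_m -> R) (u v w : 'rV[R]_m).

Lemma dir_eq_on v f h u : D u -> {in D, f =1 h} -> dir v f u = dir v h u.
Proof.
by move=> Du fh; apply: eq_bigr => i _; rewrite (partial_eq_on i oD Du fh).
Qed.

Lemma smooth_dir v f : smooth_on D f -> smooth_on D (dir v f).
Proof.
move=> sf; apply: smooth_on_sum => // i; apply: smooth_onM => //.
  exact: smooth_on_cst.
exact: smooth_on_partial.
Qed.

Lemma dir_cst v (a : R) u : dir v (fun=> a) u = 0.
Proof.
apply: big1 => i _; rewrite /partial (derive_cst (W := R : normedModType R)).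
by rewrite mulr0.
Qed.

Lemma dirD v f h u : smooth_on D f -> smooth_on D h -> D u ->
  dir v (fun y => f y + h y) u = dir v f u + dir v h u.
Proof.
move=> sf sh Du; rewrite -big_split; apply: eq_bigr => i _ /=.
by rewrite /partial (deriveD (smooth_on_derivable (i := i) sf Du)
  (smooth_on_derivable (i := i) sh Du)) mulrDr.
Qed.

Lemma dirM v f h u : smooth_on D f -> smooth_on D h -> D u ->
  dir v (fun y => f y * h y) u = dir v f u * h u + f u * dir v h u.
Proof.
move=> sf sh Du; rewrite /dir mulr_suml mulr_sumr -big_split.
apply: eq_bigr => i _ /=.
rewrite /partial (deriveM (smooth_on_derivable (i := i) sf Du)
  (smooth_on_derivable (i := i) sh Du)) /GRing.scale/=.
by move: ('D_ _ h u : R) ('D_ _ f u : R) => a b; ring.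
Qed.

Lemma dirN v f u : smooth_on D f -> D u ->
  dir v (fun y => - f y) u = - dir v f u.
Proof.
move=> sf Du; rewrite /dir -sumrN; apply: eq_bigr => i _ /=.
by rewrite /partial (deriveN (smooth_on_derivable (i := i) sf Du)) mulrN.
Qed.

Lemma dirV v f u : (forall y, D y -> f y != 0) -> smooth_on D f -> D u ->
  dir v (fun y => (f y)^-1) u = - (dir v f u * (f u)^-1 * (f u)^-1).
Proof.
move=> f0 sf Du; have H := dirM v sf (smooth_onV oD f0 sf) Du.
have : dir v (fun y => f y * (f y)^-1) u = 0.
  rewrite (@dir_eq_on v _ (fun=> 1) u Du) ?dir_cst// => y; rewrite inE => Dy.
  by rewrite mulfV// f0.
rewrite H => /eqP; rewrite addr_eq0 => /eqP E.
by rewrite E mulNr opprK mulrC mulKf// f0.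
Qed.

Lemma dir_sum (I : finType) (F : I -> 'rV[R]_m -> R) v u :
  (forall i, smooth_on D (F i)) -> D u ->
  dir v (fun y => \sum_i F i y) u = \sum_i dir v (F i) u.
Proof.
move=> sF Du; rewrite [RHS]exchange_big; apply: eq_bigr => i _ /=.
rewrite -mulr_sumr; congr (_ * _); rewrite /partial.
have E (r : seq I) : 'D_(delta_mx 0 i) (fun y => \sum_(j <- r) F j y) u =
    \sum_(j <- r) 'D_(delta_mx 0 i) (F j) u.
  elim: r => [|j r IH].
    rewrite big_nil (_ : (fun y => _) = fun=> 0); first exact: derive_cst.
    by apply/funext => y; rewrite big_nil.
  rewrite big_cons -IH -(deriveD (smooth_on_derivable (i := i) (sF j) Du)
    (smooth_on_derivable (i := i) (smooth_on_sum oD r xpredT sF) Du)).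
  by apply: eq_partial => y; rewrite big_cons.
exact: E.
Qed.

Lemma dirC v w f u : smooth_on D f -> D u ->
  dir v (dir w f) u = dir w (dir v f) u.
Proof.
move=> sf Du; have E x y : dir x (dir y f) u = \sum_i \sum_j x 0 i * (y 0 j *
    partial i (partial j f) u).
  rewrite {1}/dir; under eq_bigr => i _.
    rewrite (_ : partial i (dir y f) u =
      \sum_j y 0 j * partial i (partial j f) u); last first.
      have -> : partial i (dir y f) u = dir (delta_mx 0 i) (dir y f) u.
        rewrite /dir (bigD1 i)//= mxE !eqxx mul1r big1 ?addr0// => k ki.
        by rewrite mxE eqxx (negbTE ki) mul0r.
      rewrite dir_sum//; last first.
        move=> j; apply: smooth_onM => //; first exact: smooth_on_cst.
        exact: smooth_on_partial.
      apply: eq_bigr => j _; rewrite dirM//; last first.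
      - exact: smooth_on_partial.
      - exact: smooth_on_cst.
      rewrite dir_cst mul0r add0r /dir (bigD1 i)//= mxE !eqxx mul1r.
      by rewrite big1 ?addr0// => k ki; rewrite mxE eqxx (negbTE ki) mul0r.
    rewrite mulr_sumr; over.
  by [].
rewrite !E exchange_big; apply: eq_bigr => i _; apply: eq_bigr => j _ /=.
by rewrite mulrCA (partialC oD sf _ _ Du).
Qed.

Lemma dirZl (a : R) v f u : dir (a *: v) f u = a * dir v f u.
Proof. by rewrite /dir mulr_sumr; apply: eq_bigr => i _; rewrite mxE mulrA. Qed.

End Directional.

(** * Smoothness and differentiation of matrix functions *)

Section MatrixDirectional.
Context {R : realType} {m : nat}.
Variable D : set 'rV[R]_m.
Hypothesis oD : open D.
Implicit Types (u v w : 'rV[R]_m).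

Lemma msmooth_eq r s (F H : 'rV[R]_m -> 'M[R]_(r, s)) :
  (forall u, D u -> F u = H u) -> msmooth D F -> msmooth D H.
Proof.
move=> FH sF a b; apply: (smooth_on_eq oD) (sF a b) => u.
by rewrite inE => Du; rewrite FH.
Qed.

Lemma msmooth_cst r s (M : 'M[R]_(r, s)) : msmooth D (fun=> M).
Proof. by move=> a b; exact: smooth_on_cst. Qed.

Lemma msmoothD r s (F H : 'rV[R]_m -> 'M[R]_(r, s)) : msmooth D F ->
  msmooth D H -> msmooth D (fun u => F u + H u).
Proof.
move=> sF sH a b; apply: (smooth_on_eq oD) (smooth_onD oD (sF a b) (sH a b)).
by move=> u _; rewrite mxE.
Qed.

Lemma msmoothN r s (F : 'rV[R]_m -> 'M[R]_(r, s)) : msmooth D F ->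
  msmooth D (fun u => - F u).
Proof.
move=> sF a b; apply: (smooth_on_eq oD) (smooth_onN oD (sF a b)).
by move=> u _; rewrite mxE.
Qed.

Lemma msmoothZ r s (f : 'rV[R]_m -> R) (F : 'rV[R]_m -> 'M[R]_(r, s)) :
  smooth_on D f -> msmooth D F -> msmooth D (fun u => f u *: F u).
Proof.
move=> sf sF a b; apply: (smooth_on_eq oD) (smooth_onM oD sf (sF a b)).
by move=> u _; rewrite mxE.
Qed.

Lemma msmooth_tr r s (F : 'rV[R]_m -> 'M[R]_(r, s)) : msmooth D F ->
  msmooth D (fun u => (F u)^T).
Proof.
by move=> sF a b; apply: (smooth_on_eq oD) (sF b a) => u _; rewrite mxE.
Qed.

Lemma msmoothM r s t (F : 'rV[R]_m -> 'M[R]_(r, s))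
    (H : 'rV[R]_m -> 'M[R]_(s, t)) : msmooth D F -> msmooth D H ->
  msmooth D (fun u => F u *m H u).
Proof.
move=> sF sH a b.
have S : smooth_on D (fun u => \sum_j F u a j * H u j b).
  by apply: smooth_on_sum => // j; exact: smooth_onM.
by apply: (smooth_on_eq oD) S => u _; rewrite mxE.
Qed.

Lemma smooth_det r (F : 'rV[R]_m -> 'M[R]_r) : msmooth D F ->
  smooth_on D (fun u => \det (F u)).
Proof.
move=> sF; apply: smooth_on_sum => // p; apply: smooth_onM => //.
  exact: smooth_on_cst.
by apply: smooth_on_prod => // i; exact: sF.
Qed.

Lemma msmooth_invmx r (F : 'rV[R]_m -> 'M[R]_r) :
  (forall u, D u -> F u \in unitmx) -> msmooth D F ->
  msmooth D (fun u => invmx (F u)).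
Proof.
move=> uF sF; have d0 u : D u -> \det (F u) != 0.
  by move=> /uF; rewrite unitmxE unitfE.
have sadj : msmooth D (fun u => \adj (F u)).
  move=> a b; have S : smooth_on D (fun u => cofactor (F u) b a).
    apply: smooth_onM => //; first exact: smooth_on_cst.
    apply: smooth_det => i j.
    by apply: (smooth_on_eq oD) (sF (lift b i) (lift a j)) => u _; rewrite !mxE.
  by apply: (smooth_on_eq oD) S => u _; rewrite mxE.
apply: msmooth_eq (msmoothZ (smooth_onV oD d0 (smooth_det sF)) sadj) => u Du.
by rewrite /invmx uF.
Qed.

Lemma msmooth_block r1 r2 s1 s2 (F : 'rV[R]_m -> 'M[R]_(r1, s1))
    (G : 'rV[R]_m -> 'M[R]_(r1, s2)) (H : 'rV[R]_m -> 'M[R]_(r2, s1))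
    (K : 'rV[R]_m -> 'M[R]_(r2, s2)) :
  msmooth D F -> msmooth D G -> msmooth D H -> msmooth D K ->
  msmooth D (fun u => block_mx (F u) (G u) (H u) (K u)).
Proof.
move=> sF sG sH sK a b.
case: (split_ordP a) => i ->; case: (split_ordP b) => j ->.
- by apply: (smooth_on_eq oD) (sF i j) => u _; rewrite block_mxEul.
- by apply: (smooth_on_eq oD) (sG i j) => u _; rewrite block_mxEur.
- by apply: (smooth_on_eq oD) (sH i j) => u _; rewrite block_mxEdl.
- by apply: (smooth_on_eq oD) (sK i j) => u _; rewrite block_mxEdr.
Qed.

Lemma msmooth_mdir r s v (F : 'rV[R]_m -> 'M[R]_(r, s)) : msmooth D F ->
  msmooth D (mdir v F).
Proof.
move=> sF a b; apply: (smooth_on_eq oD) (smooth_dir oD v (sF a b)) => u _.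
by rewrite mxE.
Qed.

Lemma mdir_eq_on r s v (F H : 'rV[R]_m -> 'M[R]_(r, s)) u : D u ->
  (forall y, D y -> F y = H y) -> mdir v F u = mdir v H u.
Proof.
move=> Du FH; apply/matrixP => a b; rewrite !mxE.
by apply: dir_eq_on Du _ => // y; rewrite inE => Dy; rewrite FH.
Qed.

Lemma mdir_cst r s v (M : 'M[R]_(r, s)) u : mdir v (fun=> M) u = 0.
Proof. by apply/matrixP => a b; rewrite !mxE dir_cst. Qed.

Lemma mdirD r s v (F H : 'rV[R]_m -> 'M[R]_(r, s)) u : msmooth D F ->
  msmooth D H -> D u ->
  mdir v (fun y => F y + H y) u = mdir v F u + mdir v H u.
Proof.
move=> sF sH Du; apply/matrixP => a b; rewrite !mxE.
rewrite -(dirD v (sF a b) (sH a b) Du).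
by apply: eq_dir => y; rewrite mxE.
Qed.

Lemma mdirN r s v (F : 'rV[R]_m -> 'M[R]_(r, s)) u : msmooth D F -> D u ->
  mdir v (fun y => - F y) u = - mdir v F u.
Proof.
move=> sF Du; apply/matrixP => a b; rewrite !mxE -(dirN v (sF a b) Du).
by apply: eq_dir => y; rewrite mxE.
Qed.

Lemma mdirZ r s v (f : 'rV[R]_m -> R) (F : 'rV[R]_m -> 'M[R]_(r, s)) u :
  smooth_on D f -> msmooth D F -> D u ->
  mdir v (fun y => f y *: F y) u = dir v f u *: F u + f u *: mdir v F u.
Proof.
move=> sf sF Du; apply/matrixP => a b; rewrite !mxE -(dirM v sf (sF a b) Du).
by apply: eq_dir => y; rewrite mxE.
Qed.

Lemma mdir_tr r s v (F : 'rV[R]_m -> 'M[R]_(r, s)) u :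
  mdir v (fun y => (F y)^T) u = (mdir v F u)^T.
Proof.
apply/matrixP => a b; rewrite !mxE.
by apply: eq_dir => y; rewrite mxE.
Qed.

Lemma mdirM r s t v (F : 'rV[R]_m -> 'M[R]_(r, s))
    (H : 'rV[R]_m -> 'M[R]_(s, t)) u : msmooth D F -> msmooth D H -> D u ->
  mdir v (fun y => F y *m H y) u = mdir v F u *m H u + F u *m mdir v H u.
Proof.
move=> sF sH Du; apply/matrixP => a b; rewrite !mxE -big_split/=.
rewrite (_ : (fun y => _) = fun y => \sum_j F y a j * H y j b); last first.
  by apply/funext => y; rewrite mxE.
rewrite (dir_sum oD)//; last by move=> j; exact: smooth_onM.
by apply: eq_bigr => j _; rewrite (dirM v (sF a j) (sH j b) Du) !mxE.
Qed.

(** Differentiate [F *m invmx F = 1]; that the inverse is smooth is already known from the adjugate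
    formula. *)
Lemma mdir_invmx r v (F : 'rV[R]_m -> 'M[R]_r) u :
  (forall y, D y -> F y \in unitmx) -> msmooth D F -> D u ->
  mdir v (fun y => invmx (F y)) u =
  - (invmx (F u) *m mdir v F u *m invmx (F u)).
Proof.
move=> uF sF Du; have sI := msmooth_invmx uF sF.
have : mdir v (fun y => F y *m invmx (F y)) u = 0.
  rewrite -(mdir_cst v (1%:M : 'M[R]_r) u); apply: mdir_eq_on => // y Dy.
  by rewrite mulmxV// uF.
rewrite mdirM// => /eqP; rewrite addrC addr_eq0 => /eqP E.
by rewrite -[LHS](mulKmx (uF u Du)) E mulmxN mulmxA.
Qed.

End MatrixDirectional.

Lemma mdirZl (R : realType) (m r s : nat) (a : R) (v : 'rV[R]_m)
    (F : 'rV[R]_m -> 'M[R]_(r, s)) u :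
  mdir (a *: v) F u = a *: mdir v F u.
Proof. by apply/matrixP => i j; rewrite !mxE dirZl. Qed.

Lemma mdir0l (R : realType) (m r s : nat)
    (F : 'rV[R]_m -> 'M[R]_(r, s)) u : mdir 0 F u = 0.
Proof. by rewrite -(scale0r 0) mdirZl scale0r. Qed.

(** * The Levi-Civita connection in a chart *)

(* The connection matrix of nabla_X: its k-th row is nabla_X d_k. *)
Definition conn (R : realType) (m : nat) (g : 'rV[R]_m -> 'M[R]_m)
    (x u : 'rV[R]_m) : 'M[R]_m :=
  \matrix_(k, l) \sum_i x 0 i * christoffel g l i k u.

(** The endomorphism R(v, w) for constant, hence commuting, [v] and [w]. The products stand in
    reversed order because endomorphisms act on row vectors from the right. *)
Definition rmat (R : realType) (m : nat) (g : 'rV[R]_m -> 'M[R]_m)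
    (v w u : 'rV[R]_m) : 'M[R]_m :=
  mdir v (conn g w) u - mdir w (conn g v) u
  + conn g w u *m conn g v u - conn g v u *m conn g w u.

Lemma conn0 (R : realType) (m : nat) (g : 'rV[R]_m -> 'M[R]_m) u :
  conn g 0 u = 0.
Proof.
apply/matrixP => k l; rewrite !mxE; apply: big1 => i _.
by rewrite mxE mul0r.
Qed.

(** * Metric compatibility, Koszul's formula and curvature *)

Section LeviCivita.
Context {R : realType} {m : nat}.
Variables (D : set 'rV[R]_m) (g : 'rV[R]_m -> 'M[R]_m).
Hypothesis oD : open D.
Hypothesis sg : msmooth D g.
Hypothesis gT : forall u, D u -> (g u)^T = g u.
Hypothesis gU : forall u, D u -> g u \in unitmx.
Implicit Types (u v w x y : 'rV[R]_m).

Lemma metric_entryC u a b : D u -> g u a b = g u b a.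
Proof. by move=> Du; rewrite -[in LHS](gT Du) mxE. Qed.

Lemma partial_metricC i u a b : D u ->
  partial i (fun y => g y a b) u = partial i (fun y => g y b a) u.
Proof.
move=> Du; apply: (partial_eq_on i oD Du) => y; rewrite inE => Dy.
exact: metric_entryC.
Qed.

Lemma invmx_metricT u : D u -> (invmx (g u))^T = invmx (g u).
Proof. by move=> Du; rewrite trmx_inv gT. Qed.

Lemma smooth_christoffel k i j : smooth_on D (christoffel g k i j).
Proof.
apply: smooth_onM => //; first exact: smooth_on_cst.
apply: smooth_on_sum => // h; apply: smooth_onM => //.
  exact: (msmooth_invmx oD gU sg).
apply: smooth_onD => //; last by apply: smooth_onN => //;
  apply: smooth_on_partial; exact: sg.
by apply: smooth_onD => //; apply: smooth_on_partial; exact: sg.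
Qed.

Lemma msmooth_conn x : msmooth D (conn g x).
Proof.
move=> k l.
have S : smooth_on D (fun u => \sum_i x 0 i * christoffel g l i k u).
  apply: smooth_on_sum => // i; apply: smooth_onM => //.
    exact: smooth_on_cst.
  exact: smooth_christoffel.
by apply: (smooth_on_eq oD) S => u _; rewrite mxE.
Qed.

Lemma christoffelC k i j u : D u ->
  christoffel g k i j u = christoffel g k j i u.
Proof.
move=> Du; rewrite /christoffel; congr (_ * _); apply: eq_bigr => h _.
congr (_ * (_ - _)); first by rewrite addrC.
exact: partial_metricC.
Qed.

Lemma connC x y u : D u -> x *m conn g y u = y *m conn g x u.
Proof.
move=> Du; apply/rowP => l; rewrite !mxE.
under eq_bigr do rewrite mxE mulr_sumr.
rewrite exchange_big; apply: eq_bigr => i _; rewrite mxE mulr_sumr.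
by apply: eq_bigr => j _; rewrite mulrCA (christoffelC _ _ _ Du).
Qed.

(** Lowering the index cancels the inverse metric and leaves the Christoffel symbols of the first
    kind. *)
Lemma conn_metric x u k l : D u -> (conn g x u *m g u) k l = \sum_i x 0 i *
  (2^-1 * (partial i (fun y => g y k l) u + partial k (fun y => g y i l) u
           - partial l (fun y => g y i k) u)).
Proof.
move=> Du; rewrite mxE; under eq_bigr do rewrite mxE mulr_suml.
rewrite exchange_big; apply: eq_bigr => i _ /=.
under eq_bigr do rewrite -mulrA.
rewrite -mulr_sumr; congr (_ * _).
under eq_bigr do rewrite /christoffel -mulrA mulr_suml.
rewrite -mulr_sumr exchange_big; congr (_ * _) => /=.
rewrite (bigD1 l)//= [X in _ + X]big1 => [|h hl].
  under eq_bigr => a _ do rewrite mulrAC.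
  rewrite -mulr_suml [X in X * _](_ : _ = 1) ?mul1r ?addr0//.
  have := congr1 (fun M : 'M[R]_m => M l l) (mulVmx (gU Du)).
  rewrite !mxE eqxx /= mulr1n => <-; apply: eq_bigr => a _.
  by rewrite -[in LHS](invmx_metricT Du) mxE.
under eq_bigr => a _ do rewrite mulrAC.
rewrite -mulr_suml [X in X * _](_ : _ = 0) ?mul0r//.
have := congr1 (fun M : 'M[R]_m => M h l) (mulVmx (gU Du)).
rewrite !mxE (negbTE hl) => E; apply: etrans E; apply: eq_bigr => a _.
by rewrite -[in LHS](invmx_metricT Du) mxE.
Qed.

(** Metric compatibility: in the symmetrized symbols of the first kind only the derivative of the
    metric along [x] survives. *)
Lemma mdir_metric x u : D u ->
  mdir x g u = conn g x u *m g u + g u *m (conn g x u)^T.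
Proof.
move=> Du; have -> : g u *m (conn g x u)^T = (conn g x u *m g u)^T.
  by rewrite trmx_mul (gT Du).
apply/matrixP => k l; rewrite mxE [RHS]mxE [in X in _ + X]mxE !conn_metric//.
rewrite -big_split; apply: eq_bigr => i _ /=; rewrite -mulrDr; congr (_ * _).
rewrite (partial_metricC i l k Du) -mulrDr.
have -> a b c : a + b - c + (a + c - b) = 2 * a :> R by ring.
by rewrite mulKf// pnatr_eq0.
Qed.

Lemma smooth_inner x y : smooth_on D (fun u => inner g u x y).
Proof.
have S : msmooth D (fun u => x *m g u *m y^T).
  apply: (msmoothM oD) (msmooth_cst oD _); apply: (msmoothM oD) sg.
  exact: msmooth_cst.
exact: S.
Qed.

Lemma dir_inner x y v u : D u ->
  dir v (fun u => inner g u x y) u = (x *m mdir v g u *m y^T) 0 0.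
Proof.
move=> Du; have S : msmooth D (fun u => x *m g u).
  by apply: (msmoothM oD) sg; exact: msmooth_cst.
have := mdirM oD v S (msmooth_cst oD y^T) Du.
rewrite (mdirM oD v (msmooth_cst oD x) sg Du) !mdir_cst mulmx0 addr0.
by rewrite mul0mx add0r => <-; rewrite mxE.
Qed.

Lemma inner_sym x y u : D u -> inner g u x y = inner g u y x.
Proof.
move=> Du; rewrite /inner (_ : y *m g u *m x^T = (x *m g u *m y^T)^T).
  by rewrite [RHS]mxE.
by rewrite !trmx_mul trmxK (gT Du) mulmxA.
Qed.

Lemma innerDl x y z u : inner g u (x + y) z = inner g u x z + inner g u y z.
Proof. by rewrite /inner !mulmxDl mxE. Qed.

Lemma innerDr x y z u : inner g u z (x + y) = inner g u z x + inner g u z y.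
Proof. by rewrite /inner linearD mulmxDr mxE. Qed.

Lemma innerZl a x z u : inner g u (a *: x) z = a * inner g u x z.
Proof. by rewrite /inner -!scalemxAl mxE. Qed.

Lemma innerZr a x z u : inner g u z (a *: x) = a * inner g u z x.
Proof. by rewrite /inner linearZ/= -scalemxAr mxE. Qed.

(** Constant fields commute, so the bracket terms of Koszul's formula are absent. *)
Lemma koszul x y z u : D u -> inner g u (y *m conn g x u) z = 2^-1 *
  (dir x (fun u => inner g u y z) u + dir y (fun u => inner g u x z) u
   - dir z (fun u => inner g u x y) u).
Proof.
move=> Du; rewrite !dir_inner// !mdir_metric//.
have E a b c : (a *m (conn g b u *m g u + g u *m (conn g b u)^T) *m c^T) 0 0 =
    inner g u (a *m conn g b u) c + inner g u (c *m conn g b u) a.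
  rewrite mulmxDr mulmxDl mxE /inner !mulmxA; congr (_ + _).
  by rewrite -mulmxA -trmx_mul -/(inner g u a (c *m conn g b u)) inner_sym.
rewrite !E ![y *m _]connC// ![z *m conn g x u]connC// ![z *m conn g y u]connC//.
by field.
Qed.

Lemma curvature_opE v w u : D u ->
  curvature_op g u v w = w *m rmat g v w u.
Proof.
move=> Du; apply/rowP => l; rewrite !mxE; apply: eq_bigr => k _.
under eq_bigr do rewrite -mulr_suml.
rewrite -mulr_suml mulrC; congr (_ * _); rewrite !mxE.
have E x y : dir x (fun u => conn g y u k l) u =
    \sum_i \sum_j partial i (christoffel g l j k) u * x 0 i * y 0 j.
  apply: eq_bigr => i _; rewrite mulrC.
  rewrite (_ : partial i _ u =
    \sum_j y 0 j * partial i (christoffel g l j k) u).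
    by rewrite mulr_suml; apply: eq_bigr => j _; ring.
  have -> : partial i (fun u => conn g y u k l) u =
      dir (delta_mx 0 i) (fun u => \sum_j y 0 j * christoffel g l j k u) u.
    rewrite /dir (bigD1 i)//= mxE !eqxx mul1r big1 ?addr0.
      by apply: eq_partial => z; rewrite mxE.
    by move=> a ai; rewrite mxE eqxx (negbTE ai) mul0r.
  rewrite (dir_sum oD)//; last first.
    move=> j; apply: smooth_onM => //; first exact: smooth_on_cst.
    exact: smooth_christoffel.
  apply: eq_bigr => j _; rewrite (dirM _ (smooth_on_cst oD _)
    (smooth_christoffel _ _ _))// dir_cst mul0r add0r; congr (_ * _).
  rewrite /dir (bigD1 i)//= mxE !eqxx mul1r big1 ?addr0//.
  by move=> a ai; rewrite mxE eqxx (negbTE ai) mul0r.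
rewrite !E.
have F x y : \sum_h conn g y u k h * conn g x u h l = \sum_i \sum_j
    (\sum_h christoffel g l i h u * christoffel g h j k u) * x 0 i * y 0 j.
  under eq_bigr do rewrite !mxE mulr_sumr.
  rewrite exchange_big; apply: eq_bigr => i _ /=.
  under eq_bigr do rewrite mulr_suml.
  rewrite exchange_big; apply: eq_bigr => j _ /=.
  by rewrite -mulrA mulr_suml; apply: eq_bigr => h _; ring.
rewrite !F [X in _ - X + _ - _]exchange_big [X in _ + _ - X]exchange_big /=.
rewrite -!sumrN -!big_split; apply: eq_bigr => i _ /=.
rewrite -!sumrN -!big_split; apply: eq_bigr => j _ /=.
rewrite /riemann big_split sumrN /=.
move: (partial i _ u) (partial j _ u) (\sum_h _) (\sum_h _) => a b c d.
ring.
Qed.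

(** Differentiate <nabla_w w, y> along [v] and <nabla_v w, y> along [w]: metric compatibility turns
    the difference into <R(v, w) w, y> plus products of first covariant derivatives, and Koszul's
    formula writes the differentiated functions through the metric alone. *)
Lemma inner_curvature v w y u : D u ->
  let f a b := fun u => inner g u a b in
  inner g u (curvature_op g u v w) y =
    dir v (fun u => 2^-1 * (dir w (f w y) u + dir w (f w y) u
                            - dir y (f w w) u)) u
  - dir w (fun u => 2^-1 * (dir v (f w y) u + dir w (f v y) u
                            - dir y (f v w) u)) u
  - inner g u (w *m conn g w u) (y *m conn g v u)
  + inner g u (w *m conn g v u) (y *m conn g w u).
Proof.
move=> Du f; rewrite curvature_opE//.
have K a b : dir a (fun u => 2^-1 * (dir b (f w y) u + dir w (f b y) u
      - dir y (f b w) u)) u =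
    inner g u (w *m mdir a (conn g b) u) y
    + inner g u (w *m conn g b u *m conn g a u) y
    + inner g u (w *m conn g b u) (y *m conn g a u).
  rewrite (@dir_eq_on _ _ _ oD a _
    (fun u => inner g u (w *m conn g b u) y) u Du); last first.
    by move=> z; rewrite inE => Dz; rewrite koszul.
  have S1 : msmooth D (fun u => w *m conn g b u).
    by apply: (msmoothM oD (msmooth_cst oD _)); exact: msmooth_conn.
  have S2 : msmooth D (fun u => w *m conn g b u *m g u) by exact: msmoothM.
  have S3 := msmooth_cst oD y^T.
  transitivity (mdir a (fun u => w *m conn g b u *m g u *m y^T) u 0 0).
    by rewrite mxE.
  rewrite (mdirM oD a S2 S3 Du) mdir_cst mulmx0 addr0 (mdirM oD a S1 sg Du).
  rewrite (mdirM oD a (msmooth_cst oD w) (msmooth_conn b) Du) mdir_cst.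
  rewrite mul0mx add0r.
  have D00 (M N : 'M[R]_1) : (M + N) 0 0 = M 0 0 + N 0 0 by rewrite mxE.
  rewrite mdir_metric// !(mulmxDl, mulmxDr) !D00 addrA /inner trmx_mul.
  by rewrite !mulmxA.
rewrite !K /rmat !(mulmxDr, mulmxDl, mulmxN, mulNmx) !innerDl.
have N a : inner g u (- a) y = - inner g u a y.
  by rewrite -scaleN1r innerZl mulN1r.
rewrite !N !mulmxA; ring.
Qed.

End LeviCivita.

(** * The curvature tensor of a metric of constant curvature *)

Section ConstantCurvature.
Context {R : realType} {m : nat}.
Variables (D : set 'rV[R]_m) (g : 'rV[R]_m -> 'M[R]_m).
Hypothesis oD : open D.
Hypothesis sg : msmooth D g.
Hypothesis gT : forall u, D u -> (g u)^T = g u.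
Hypothesis gU : forall u, D u -> g u \in unitmx.
Implicit Types (u v w x y : 'rV[R]_m).

Lemma dir_half v u (f1 f2 f3 : 'rV[R]_m -> R) : smooth_on D f1 ->
  smooth_on D f2 -> smooth_on D f3 -> D u ->
  dir v (fun u => 2^-1 * (f1 u + f2 u - f3 u)) u =
  2^-1 * (dir v f1 u + dir v f2 u - dir v f3 u).
Proof.
move=> s1 s2 s3 Du; have s12 := smooth_onD oD s1 s2.
have s3N := smooth_onN oD s3.
rewrite (dirM v (smooth_on_cst oD _) (smooth_onD oD s12 s3N) Du) dir_cst mul0r.
by rewrite add0r (dirD v s12 s3N Du) (dirD v s1 s2 Du) (dirN v s3 Du).
Qed.

Lemma dir2_innerC a b x y u : D u ->
  dir a (dir b (fun u => inner g u x y)) u =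
  dir a (dir b (fun u => inner g u y x)) u.
Proof.
move=> Du; apply: (dir_eq_on oD a Du) => z; rewrite inE => Dz.
apply: (dir_eq_on oD b Dz) => t; rewrite inE => Dt.
exact: (inner_sym gT).
Qed.

Lemma inner_curvature_expanded v w y u : D u ->
  let f a b := fun u => inner g u a b in
  inner g u (curvature_op g u v w) y =
    2^-1 * (dir v (dir w (f w y)) u + dir w (dir y (f v w)) u
            - dir v (dir y (f w w)) u - dir w (dir w (f v y)) u)
  - inner g u (w *m conn g w u) (y *m conn g v u)
  + inner g u (v *m conn g w u) (y *m conn g w u).
Proof.
move=> Du f; rewrite (inner_curvature oD sg gT gU)//.
have s a b x : smooth_on D (dir a (fun u => inner g u b x)).
  by apply: smooth_dir => //; exact: smooth_inner.
rewrite !dir_half// (connC oD gT w v Du).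
rewrite (dirC oD w v (smooth_inner oD sg w y) Du) /f.
move: (dir v (dir w _) u) (dir w (dir y _) u).
move: (dir v (dir y _) u) (dir w (dir w _) u).
by move: (inner g u _ _) (inner g u _ _) => e k a b c d; field.
Qed.

Lemma swap_addends (h a b c d e k : R) :
  h * (a + b - c - d) - e + k = h * (b + a - c - d) - e + k.
Proof. by rewrite (addrC a). Qed.

(** Exchanging [v] and [y] only permutes terms of the expansion, by the symmetry of second
    derivatives, of the metric and of the connection. Polarization depends on this symmetry. *)
Lemma jacobi_sym v w y u : D u ->
  inner g u (curvature_op g u v w) y = inner g u (curvature_op g u y w) v.
Proof.
move=> Du; rewrite !inner_curvature_expanded//.
rewrite (dir2_innerC v w w y Du) (dir2_innerC y w w v Du).
rewrite (dirC oD w y (smooth_inner oD sg v w) Du).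
rewrite (dirC oD w v (smooth_inner oD sg y w) Du).
rewrite (dirC oD y v (smooth_inner oD sg w w) Du).
rewrite (dir2_innerC w w v y Du) (connC oD gT y v Du).
rewrite (inner_sym gT (v *m conn g w u) _ Du).
exact: swap_addends.
Qed.

Lemma curvature_opD v y w u :
  curvature_op g u (v + y) w = curvature_op g u v w + curvature_op g u y w.
Proof.
apply/rowP => l; rewrite !mxE -big_split; apply: eq_bigr => k _ /=.
rewrite -big_split; apply: eq_bigr => i _ /=.
rewrite -big_split; apply: eq_bigr => j _ /=.
by rewrite mxE mulrDr !mulrDl.
Qed.

Lemma curvature_opZ a w u : D u -> curvature_op g u (a *: w) w = 0.
Proof.
move=> Du; have -> : curvature_op g u (a *: w) w = a *: curvature_op g u w w.
  apply/rowP => l; rewrite !mxE mulr_sumr; apply: eq_bigr => k _ /=.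
  rewrite mulr_sumr; apply: eq_bigr => i _ /=.
  rewrite mulr_sumr; apply: eq_bigr => j _ /=.
  by rewrite mxE mulrCA !mulrA.
by rewrite (curvature_opE oD sg gU)// /rmat subrr add0r subrr mulmx0 scaler0.
Qed.

Lemma curvature_op0 v u : curvature_op g u v 0 = 0.
Proof.
apply/rowP => l; rewrite !mxE; apply: big1 => k _; apply: big1 => i _.
by apply: big1 => j _; rewrite !mxE !mulr0.
Qed.

Lemma not_row_free2 v w : ~~ row_free (col_mx v w) ->
  w = 0 \/ exists a, v = a *: w.
Proof.
rewrite -kermx_eq0 => /rowV0Pn[x]; rewrite sub_kermx => /eqP xvw x0.
move: xvw x0; rewrite -[x]hsubmxK mul_row_col.
rewrite [lsubmx x]mx11_scalar [rsubmx x]mx11_scalar !mul_scalar_mx.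
move: (lsubmx x 0 0) (rsubmx x 0 0) => a b /eqP; rewrite addr_eq0 => /eqP E x0.
have [a0|a0] := eqVneq a 0; last first.
  by right; exists (- (a^-1 * b)); rewrite scaleNr -scalerA -scalerN -E scalerK.
left; have b0 : b != 0.
  by apply: contraNneq x0 => ->; rewrite a0 !raddf0 row_mx0.
apply/eqP; move/eqP: E; rewrite a0 scale0r eq_sym oppr_eq0 scaler_eq0.
by rewrite (negbTE b0).
Qed.

(** The sectional curvature fixes the symmetric form <R(v, w) w, v> on the diagonal; polarizing in
    [v] recovers the whole form. *)
Lemma constant_curvature_jacobi (c : R) u : D u -> c != 0 ->
  (forall v w, row_free (col_mx v w) -> sectional_curvature g u v w = c) ->
  forall v w y, inner g u (curvature_op g u v w) y =
    c * (inner g u v y * inner g u w w - inner g u v w * inner g u w y).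
Proof.
move=> Du c0 sec.
have diag v w : inner g u (curvature_op g u v w) v =
    c * (inner g u v v * inner g u w w - inner g u v w * inner g u w v).
  rewrite (inner_sym gT w v Du) -expr2.
  have [rf|] := boolP (row_free (col_mx v w)).
    have E := sec _ _ rf; rewrite -[X in X * _]E /sectional_curvature divfK//.
    (* A vanishing Gram determinant would make the quotient 0, as the inverse of 0 is 0, against
       [c != 0]. *)
    apply: contra_neq c0 => d0; rewrite -E /sectional_curvature d0 invr0.
    by rewrite mulr0.
  (* The hypothesis says nothing about dependent pairs; there both sides vanish. *)
  case/not_row_free2 => [->|[a ->]].
    by rewrite curvature_op0 /inner linear0 !(mul0mx, mulmx0) !mxE; ring.
  rewrite curvature_opZ// !(innerZl, innerZr) {1}/inner !mul0mx mxE; ring.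
move=> v w y; have := diag (v + y) w.
rewrite curvature_opD !(innerDl, innerDr) !diag (jacobi_sym y w v Du).
rewrite (inner_sym gT y v Du) (inner_sym gT w v Du) (inner_sym gT w y Du).
move: (inner g u (curvature_op g u v w) y) => J E.
have {}E : 2 * J = 2 * (c * (inner g u v y * inner g u w w
    - inner g u v w * inner g u y w)).
  move: E; move: (inner g u v v) (inner g u y y) (inner g u w w)
    (inner g u v y) (inner g u v w) (inner g u y w) => p q r s t z E.
  by lra.
by apply: (mulfI _ E); rewrite pnatr_eq0.
Qed.

End ConstantCurvature.

(** * Derivatives of base functions and of the fibre coordinate *)

Section BundlePullback.
Context {R : realType} {n1 n2 : nat}.
Implicit Types (z x : 'rV[R]_(n1 + n2)).

Lemma dir_lsubmx (f : 'rV[R]_n1 -> R) x z :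
  dir x (fun y => f (lsubmx y)) z = dir (lsubmx x) f (lsubmx z).
Proof.
rewrite /dir big_split_ord /= [X in _ + X]big1 ?addr0 => [|i _].
  by apply: eq_bigr => i _; rewrite partial_lsubmx_lshift mxE.
by rewrite partial_lsubmx_rshift mulr0.
Qed.

Lemma mdir_lsubmx r s (F : 'rV[R]_n1 -> 'M[R]_(r, s)) x z :
  mdir x (fun y => F (lsubmx y)) z = mdir (lsubmx x) F (lsubmx z).
Proof. by apply/matrixP => a b; rewrite !mxE -dir_lsubmx. Qed.

Lemma msmooth_lsubmx (D : set 'rV[R]_n1) (E : set 'rV[R]_(n1 + n2)) r s
    (F : 'rV[R]_n1 -> 'M[R]_(r, s)) :
  open E -> (forall z, E z -> D (lsubmx z)) -> msmooth D F ->
  msmooth E (fun z => F (lsubmx z)).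
Proof. by move=> oE ED sF a b; exact: (smooth_on_lsubmx oE ED (sF a b)). Qed.

Lemma msmooth_rsubmx (E : set 'rV[R]_(n1 + n2)) : open E ->
  msmooth E (fun z => rsubmx z).
Proof.
move=> oE a b; rewrite ord1.
apply: (smooth_on_eq oE) (smooth_on_coord (rshift n1 b) oE) => z _.
by rewrite mxE.
Qed.

Lemma mdir_rsubmx x z : mdir x (fun y => rsubmx y) z = rsubmx x.
Proof.
apply/rowP => b; rewrite !mxE.
rewrite (@eq_dir _ _ x _ (fun y => y 0 (rshift n1 b))) => [|y]; last first.
  by rewrite mxE.
rewrite /dir (bigD1 (rshift n1 b))//= partial_coord eqxx mulr1 big1 ?addr0//.
by move=> i ib; rewrite partial_coord (negbTE ib) mulr0.
Qed.

End BundlePullback.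

(** Conjugation by the inverse turns the action of a connection on a covariant 2-tensor into its
    action on a contravariant one; this gives the derivative of [Hv] from that of [Gh]. *)
Lemma mul_inverse_sandwich (R : comUnitRingType) (n : nat)
    (G H N N' E : 'M[R]_n) : G *m H = 1%:M ->
  H *m (N *m G + G *m N' + E) *m H = H *m N + N' *m H + H *m E *m H.
Proof.
move=> GH; have HG := mulmx1C GH; rewrite !(mulmxDr, mulmxDl).
congr (_ + _ + _); first by rewrite -!mulmxA GH mulmx1.
by rewrite !mulmxA HG mul1mx.
Qed.

(** * The tube in an induced chart *)

Lemma inner_inj (R : realType) (m : nat) (g : 'rV[R]_m -> 'M[R]_m)
    (u x y : 'rV[R]_m) : g u \in unitmx ->
  (forall v, inner g u x v = inner g u y v) -> x = y.
Proof.
move=> gu xy; rewrite -[x](mulmxK gu) -[y](mulmxK gu); congr (_ *m _).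
apply/rowP => j; have := xy (delta_mx 0 j); rewrite /inner trmx_delta.
by rewrite -!colE !mxE.
Qed.

(** * Scalars as 1 x 1 matrices *)

Section OneByOne.
Context {R : comNzRingType}.
Implicit Types (M N : 'M[R]_1).

Lemma mx11D M N : (M + N) 0 0 = M 0 0 + N 0 0. Proof. by rewrite mxE. Qed.

Lemma mx11N M : (- M) 0 0 = - M 0 0. Proof. by rewrite mxE. Qed.

Lemma mx11Z (k : R) M : (k *: M) 0 0 = k * M 0 0. Proof. by rewrite mxE. Qed.

Lemma mx11_trmul (n : nat) (x y : 'rV[R]_n) :
  (x *m y^T) 0 0 = (y *m x^T) 0 0.
Proof. by rewrite -[x *m _]trmxK trmx_mul trmxK mxE. Qed.

Lemma mul_outer (n : nat) (x y w : 'rV[R]_n) :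
  x *m (y^T *m w) = (x *m y^T) 0 0 *: w.
Proof. by rewrite mulmxA [x *m y^T]mx11_scalar mul_scalar_mx !mxE mulr1n. Qed.

Lemma mx11_outer (n : nat) (x y w v : 'rV[R]_n) :
  (x *m (y^T *m w) *m v^T) 0 0 = (x *m y^T) 0 0 * (w *m v^T) 0 0.
Proof. by rewrite mul_outer -scalemxAl mx11Z. Qed.

Lemma mx11_form (n : nat) (x y : 'rV[R]_n) (B : 'M[R]_n) :
  (x *m B *m y^T) 0 0 = (y *m B^T *m x^T) 0 0.
Proof. by rewrite mx11_trmul trmx_mul mulmxA. Qed.

Lemma scalar_tr M : M^T = M.
Proof. by apply/matrixP => i j; rewrite mxE !ord1. Qed.

End OneByOne.

(* [b] is chosen so that the Cauchy-Schwarz inequality for [p] and [b] is strict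
   although the two are not orthogonal. *)
Lemma exists_oblique (R : realType) (n : nat) (h : 'M[R]_n) (p : 'rV[R]_n) :
  (2 <= n)%N -> h^T = h ->
  (forall e : 'rV[R]_n, e != 0 -> 0 < (e *m h *m e^T) 0 0) -> p != 0 ->
  exists b : 'rV[R]_n, (p *m h *m b^T) 0 0 != 0 /\
    0 < (b *m h *m b^T) 0 0
        - (p *m h *m b^T) 0 0 ^+ 2 / (p *m h *m p^T) 0 0.
Proof.
move=> n2 hT hpos p0; have P0 := hpos _ p0.
have [i pi0] : exists i, p 0 i != 0.
  apply/existsP; apply: contraNT p0 => /existsPn pz.
  by apply/eqP/rowP => i; rewrite mxE; apply/eqP/negPn/pz.
have [j ji] : exists j : 'I_n, j != i.
  have n0 : (0 < n)%N by exact: ltnW.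
  have [i0|i0] := eqVneq (i : nat) 0%N.
    by exists (Ordinal n2); rewrite -val_eqE/= i0.
  by exists (Ordinal n0); rewrite -val_eqE/= eq_sym.
pose X : 'rV[R]_n := delta_mx 0 j.
have XE k : X 0 k = (k == j)%:R by rewrite mxE eqxx.
move: X XE P0 => X XE; set P := (p *m h *m p^T) 0 0 => P0.
pose s := (p *m h *m X^T) 0 0; pose Q := (X *m h *m X^T) 0 0.
have form (x y : R) : ((x *: X + y *: p) *m h *m (x *: X + y *: p)^T) 0 0 =
    x ^+ 2 * Q + 2 * x * y * s + y ^+ 2 * P.
  rewrite linearD !linearZ/= !(mulmxDr, mulmxDl) -!(scalemxAl, scalemxAr).
  rewrite !(mx11D, mx11Z) -/P -/Q -/s.
  have -> : (X *m h *m p^T) 0 0 = s by rewrite mx11_form hT.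
  by ring.
(* [P *: X - s *: p] is [P] times the part of [X] orthogonal to [p]. It is nonzero: its entry at [i]
   forces s = 0, and then its entry at [j] is [P]. *)
have gram : 0 < Q - s ^+ 2 / P.
  have y0 : P *: X + (- s) *: p != 0.
    apply/eqP => /rowP y0; have := y0 i; rewrite !mxE XE eq_sym (negbTE ji).
    rewrite mulr0 add0r => /eqP; rewrite mulNr oppr_eq0 mulf_eq0.
    rewrite (negbTE pi0) orbF => /eqP s0.
    have := y0 j; rewrite !mxE XE eqxx s0 oppr0 mul0r addr0 mulr1 => /eqP.
    by rewrite gt_eqF.
  have := hpos _ y0; rewrite form.
  have -> : P ^+ 2 * Q + 2 * P * - s * s + (- s) ^+ 2 * P =
    P ^+ 2 * (Q - s ^+ 2 / P) by field; rewrite gt_eqF.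
  by rewrite pmulr_rgt0// exprn_gt0.
have pairX (y : R) : (p *m h *m (1 *: X + y *: p)^T) 0 0 = s + y * P.
  rewrite linearD !linearZ/= mulmxDr -!scalemxAr mx11D !mx11Z.
  by rewrite -/s -/P mul1r.
(* Adding a multiple of [p] does not change the part orthogonal to [p], so it can be used to make
   the pairing with [p] nonzero. *)
have shear (y : R) : ((1 *: X + y *: p) *m h *m (1 *: X + y *: p)^T) 0 0
    - (p *m h *m (1 *: X + y *: p)^T) 0 0 ^+ 2 / P = Q - s ^+ 2 / P.
  by rewrite form pairX; field; rewrite gt_eqF.
have [s0|s0] := eqVneq s 0.
  exists (1 *: X + 1 *: p); rewrite shear; split=> //.
  by rewrite pairX s0 add0r mul1r gt_eqF.
by exists (1 *: X + 0 *: p); rewrite shear pairX mul0r addr0.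
Qed.

(** [V0] is [V] for W = 0 and s = 2 t, the values that belong to b = p. Its quotient is A / 2, and
    the other one exceeds it by a positive term. *)
Lemma curvature_values_differ (R : realType) (A t d W s k : R) :
  0 < A -> 0 < t -> 0 < d -> 0 < W -> s != 0 ->
  let V := W / (A * t) + A * s ^+ 2 / (2 * t * d) in
  let V0 := A * (2 * t) ^+ 2 / (2 * t * d) in
  (A / 2 * V0 ^+ 2) / V0 ^+ 2 = k ->
  (A / 2 * V ^+ 2 + A * s ^+ 2 * W / (t ^+ 2 * d)) / V ^+ 2 <> k.
Proof.
move=> A0 t0 d0 W0 s0 V V0 <-.
have s2 : 0 < s ^+ 2 by rewrite exprn_even_gt0.
have At : 0 < A * t by exact: mulr_gt0.
have t2 : 0 < 2 * t by rewrite mulr_gt0.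
have td : 0 < 2 * t * d by exact: mulr_gt0.
have Vp : 0 < V by apply: addr_gt0; apply: divr_gt0 => //; exact: mulr_gt0.
have V0p : 0 < V0.
  by apply: divr_gt0 => //; apply: mulr_gt0 => //; exact: exprn_gt0.
have E : 0 < A * s ^+ 2 * W / (t ^+ 2 * d).
  apply: divr_gt0; first by apply: mulr_gt0 => //; exact: mulr_gt0.
  by apply: mulr_gt0 => //; exact: exprn_gt0.
rewrite mulfK ?expf_neq0 ?gt_eqF// mulrDl mulfK ?expf_neq0 ?gt_eqF// => /eqP.
by rewrite -subr_eq0 addrAC subrr add0r gt_eqF// divr_gt0// exprn_gt0.
Qed.

(** * The tube over one chart and the blocks of its metric *)

Section Tube.
Context {R : realType} {n : nat}.
Variables (D : set 'rV[R]_n) (g : 'rV[R]_n -> 'M[R]_n) (c A : R).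
Hypothesis oD : open D.
Hypothesis sg : msmooth D g.
Hypothesis gT : forall u, D u -> (g u)^T = g u.
Hypothesis gU : forall u, D u -> g u \in unitmx.
Hypothesis c_gt0 : 0 < c.
Hypothesis A_gt0 : 0 < A.
Implicit Types (z x y : 'rV[R]_(n + n)) (e : 'rV[R]_n).

Definition tube_dom : set 'rV[R]_(n + n) :=
  [set z | D (lsubmx z) /\ 0 < cov_sqnorm g z < 4 * c / A ^+ 2].

Let gq z := g (lsubmx z).
Let h z := invmx (gq z).
Let p z : 'rV[R]_n := rsubmx z.
Let M e z := conn g e (lsubmx z).

Lemma cov_sqnormE z : cov_sqnorm g z = (p z *m h z *m (p z)^T) 0 0.
Proof.
rewrite mxE /cov_sqnorm exchange_big; apply: eq_bigr => k _ /=.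
rewrite !mxE mulr_suml.
by apply: eq_bigr => i _; rewrite !mxE; congr (_ * _); rewrite mulrC.
Qed.

Let base_dom : set 'rV[R]_(n + n) := [set z | D (lsubmx z)].

Lemma open_base_dom : open base_dom.
Proof.
apply: (@open_comp _ _ (@lsubmx R 1 n n)) => // z _.
exact/differentiable_continuous/differentiable_lsubmx.
Qed.

Lemma smooth_cov_sqnorm : smooth_on base_dom (cov_sqnorm g).
Proof.
have oE := open_base_dom.
have sp := msmooth_rsubmx (n1 := n) (n2 := n) oE.
have sgq : msmooth base_dom gq by apply: (msmooth_lsubmx oE _ sg).
have sh : msmooth base_dom h by apply: msmooth_invmx => // z /gU.
have S := msmoothM oE (msmoothM oE sp sh) (msmooth_tr oE sp).
by apply: (smooth_on_eq oE) (S 0 0) => z _; rewrite cov_sqnormE.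
Qed.

Lemma open_tube_dom : open tube_dom.
Proof.
have oE := open_base_dom.
rewrite openE => z [Dz tz]; rewrite /interior.
have : nbhs z base_dom by apply: open_nbhs_nbhs.
have : \forall y \near z, cov_sqnorm g y \in `]0, (4 * c / A ^+ 2)[%R.
  have N : \forall s \near cov_sqnorm g z, s \in `]0, (4 * c / A ^+ 2)[%R.
    by apply: near_in_itvoo; rewrite in_itv.
  exact: (smooth_on_continuous smooth_cov_sqnorm Dz N).
apply: filterS2 => y ty Dy; split=> //.
Qed.

Let oT := open_tube_dom.

Lemma tube_domW z : tube_dom z -> D (lsubmx z).
Proof. by case. Qed.

Lemma energy_gt0 z : tube_dom z -> 0 < energy g z.
Proof. by case=> _ /andP[t0 _]; rewrite mulr_gt0// invr_gt0. Qed.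

Lemma energy_lt z : tube_dom z -> 0 < 2 * c - A ^+ 2 * energy g z.
Proof.
case=> _ /andP[_]; rewrite ltr_pdivlMr ?exprn_gt0// => tA.
rewrite /energy; have -> : 2 * c - A ^+ 2 * (2^-1 * cov_sqnorm g z) =
  2^-1 * (4 * c - cov_sqnorm g z * A ^+ 2) by field.
by rewrite mulr_gt0 ?invr_gt0// subr_gt0.
Qed.

Lemma msmooth_cov : msmooth tube_dom p.
Proof. exact: msmooth_rsubmx. Qed.

Lemma msmooth_gq : msmooth tube_dom gq.
Proof. by apply: (msmooth_lsubmx oT _ sg) => z []. Qed.

Lemma msmooth_hq : msmooth tube_dom h.
Proof. by apply: (msmooth_invmx oT) msmooth_gq => z [/gU]. Qed.

Lemma msmooth_Mq e : msmooth tube_dom (M e).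
Proof.
apply: (msmooth_lsubmx oT _ (msmooth_conn oD sg gU e)); exact: tube_domW.
Qed.

Lemma smooth_energy : smooth_on tube_dom (energy g).
Proof.
apply: (smooth_onM oT); first exact: smooth_on_cst.
by apply: smooth_on_sub smooth_cov_sqnorm => z [].
Qed.

Lemma hqT z : D (lsubmx z) -> (h z)^T = h z.
Proof. by move=> Dz; rewrite (invmx_metricT gT Dz). Qed.

Lemma mdir_gq x z : tube_dom z ->
  mdir x gq z = M (lsubmx x) z *m gq z + gq z *m (M (lsubmx x) z)^T.
Proof.
by move=> /tube_domW Dz; rewrite mdir_lsubmx (mdir_metric oD gT gU).
Qed.

Lemma mdir_hq x z : tube_dom z ->
  mdir x h z = - (h z *m M (lsubmx x) z + (M (lsubmx x) z)^T *m h z).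
Proof.
move=> Tz; have gzU := gU (tube_domW Tz).
rewrite (mdir_invmx oT x _ msmooth_gq Tz) => [|y [/gU]//].
rewrite mdir_gq// mulmxDr mulmxDl mulmxA (mulmxK gzU) mulmxA (mulVmx gzU).
by rewrite mul1mx.
Qed.

(* The fibre component of a tangent vector in the adapted frame. *)
Definition ver x z : 'rV[R]_n := rsubmx x - p z *m (M (lsubmx x) z)^T.

Definition pair_cov z (b : 'rV[R]_n) : R := (p z *m h z *m b^T) 0 0.

(** Parallel transport preserves norms, so the energy is constant in horizontal directions: the
    terms containing the connection cancel. *)
Lemma dir_energy x z : tube_dom z ->
  dir x (energy g) z = pair_cov z (ver x z).
Proof.
move=> Tz; have Dz := tube_domW Tz.
have sp := msmooth_cov; have sh := msmooth_hq.
have sph := msmoothM oT sp sh; have spt := msmooth_tr oT sp.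
rewrite (dirM x (smooth_on_cst oT _) (smooth_on_sub _ smooth_cov_sqnorm) Tz);
  last by move=> y [].
rewrite dir_cst mul0r add0r.
have -> : dir x (cov_sqnorm g) z =
    (mdir x (fun y => p y *m h y *m (p y)^T) z) 0 0.
  by rewrite mxE; apply: eq_dir => y; rewrite cov_sqnormE.
rewrite (mdirM oT x sph spt Tz) (mdirM oT x sp sh Tz) mdir_tr mdir_rsubmx.
rewrite mdir_hq// /pair_cov /ver [(rsubmx x - _)^T]linearB/= trmx_mul trmxK.
rewrite !(mulmxDr, mulmxDl, mulmxN, mulNmx) !mulmxA.
set X := p z *m h z *m (rsubmx x)^T; set Y := _ *m M _ z *m _.
have -> : rsubmx x *m h z *m (p z)^T = X.
  by rewrite -[LHS]scalar_tr !trmx_mul trmxK (hqT Dz) mulmxA.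
have -> : p z *m (M (lsubmx x) z)^T *m h z *m (p z)^T = Y.
  by rewrite -[LHS]scalar_tr !trmx_mul !trmxK (hqT Dz) !mulmxA.
by rewrite !mxE; move: (X 0 0) (Y 0 0) => r s; field.
Qed.

(* [locked] keeps unification from expanding these sums of matrices. *)
Definition Gh z : 'M[R]_n :=
  locked ((A * energy g z) *: gq z
  + (c * (A * energy g z)^-1 - A) *: ((p z)^T *m p z)).

Lemma GhE z : Gh z =
  (A * energy g z) *: gq z
  + (c * (A * energy g z)^-1 - A) *: ((p z)^T *m p z).
Proof. by rewrite /Gh -lock. Qed.

Lemma Gh_G_hor z : tube_dom z -> Gh z = G_hor c A g z.
Proof.
move=> Tz; have t0 := lt0r_neq0 (energy_gt0 Tz).
apply/matrixP => i j; rewrite GhE !mxE big_ord1 !mxE; congr (_ + _).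
rewrite -[RHS]mulrA; congr (_ * _).
by move: (energy g z) t0 => t t0; field; rewrite t0 gt_eqF.
Qed.

Lemma GhT z : D (lsubmx z) -> (Gh z)^T = Gh z.
Proof.
move=> Dz; rewrite GhE linearD/= !linearZ/= (gT Dz) trmx_mul trmxK.
by [].
Qed.

Definition Hv z : 'M[R]_n :=
  locked ((A * energy g z)^-1 *: h z
  - ((c - A ^+ 2 * energy g z)
      / (A * energy g z ^+ 2 * (2 * c - A ^+ 2 * energy g z)))
    *: ((p z *m h z)^T *m (p z *m h z))).

Lemma HvE z : Hv z =
  (A * energy g z)^-1 *: h z
  - ((c - A ^+ 2 * energy g z)
      / (A * energy g z ^+ 2 * (2 * c - A ^+ 2 * energy g z)))
    *: ((p z *m h z)^T *m (p z *m h z)).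
Proof. by rewrite /Hv -lock. Qed.

Lemma cov_raiseE z i : cov_raise g z i = (p z *m h z) 0 i.
Proof. by rewrite mxE; apply: eq_bigr => k _. Qed.

Lemma Hv_H_ver z : Hv z = H_ver c A g z.
Proof.
apply/matrixP => i j; rewrite HvE [LHS]mxE [in LHS]mxE [in X in _ + X]mxE.
rewrite 2![in X in _ - X]mxE big_ord1 [in X in _ - X]mxE -!cov_raiseE [RHS]mxE.
by rewrite mulrA.
Qed.

(** Inversion of a rank one perturbation, using g^ik p_i p_k = 2 t. The factor 2 c - A^2 t comes
    from A t + 2 t (c / (A t) - A) = (2 c - A^2 t) / A. *)
Lemma Gh_Hv z : tube_dom z -> Gh z *m Hv z = 1%:M.
Proof.
move=> Tz; have Dz := tube_domW Tz.
have t0 := lt0r_neq0 (energy_gt0 Tz); have s0 := lt0r_neq0 (energy_lt Tz).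
have gzU := gU Dz.
have tE : p z *m h z *m (p z)^T = (2 * energy g z)%:M.
  by rewrite [LHS]mx11_scalar -cov_sqnormE /energy mulVKf ?pnatr_eq0.
rewrite GhE HvE !(mulmxBr, mulmxDl) -!scalemxAl -!scalemxAr.
rewrite (mulmxV gzU) !scalerA.
have -> : gq z *m ((p z *m h z)^T *m (p z *m h z)) = (p z)^T *m (p z *m h z).
  by rewrite trmx_mul (hqT Dz) !mulmxA (mulmxV gzU) mul1mx.
have -> : (p z)^T *m p z *m ((p z *m h z)^T *m (p z *m h z)) =
    (2 * energy g z) *: ((p z)^T *m (p z *m h z)).
  transitivity ((p z)^T *m (p z *m (p z *m h z)^T) *m (p z *m h z)).
    by rewrite !mulmxA.
  rewrite [(p z *m h z)^T]trmx_mul (hqT Dz) [p z *m _]mulmxA tE mul_mx_scalar.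
  by rewrite -scalemxAl.
rewrite -[(p z)^T *m p z *m h z]mulmxA scalerA.
move: ((p z)^T *m _) => N; move: (energy g z) t0 s0 => t t0 s0.
have -> : A * t / (A * t) = 1 by rewrite divff// mulf_neq0// gt_eqF.
rewrite scale1r -addrA -scalerDl -scalerBl.
rewrite [X in X *: N](_ : _ = 0) ?scale0r ?addr0//.
by field; rewrite t0 s0 gt_eqF.
Qed.

Lemma Gh_unit z : tube_dom z -> Gh z \in unitmx.
Proof. by move=> Tz; have [] := mulmx1_unit (Gh_Hv Tz). Qed.

Lemma Hv_inv z : tube_dom z -> Hv z = invmx (Gh z).
Proof.
by move=> Tz; rewrite -[LHS](mulKmx (Gh_unit Tz)) (Gh_Hv Tz) mulmx1.
Qed.

Lemma HvT z : tube_dom z -> (Hv z)^T = Hv z.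
Proof.
by move=> Tz; rewrite Hv_inv// trmx_inv GhT//; exact: tube_domW.
Qed.

Lemma smooth_inv_energy : smooth_on tube_dom (fun z => (A * energy g z)^-1).
Proof.
apply: (smooth_onV oT) => [z Tz|].
  by rewrite mulf_neq0 ?gt_eqF//; exact: energy_gt0.
exact: (smooth_onM oT (smooth_on_cst oT A) smooth_energy).
Qed.

Lemma smooth_kappa : smooth_on tube_dom (fun z => c * (A * energy g z)^-1 - A).
Proof.
apply: (smooth_onD oT); last exact: smooth_on_cst.
exact: (smooth_onM oT (smooth_on_cst oT c) smooth_inv_energy).
Qed.

Lemma smooth_lambda : smooth_on tube_dom (fun z => A * energy g z).
Proof. exact: (smooth_onM oT (smooth_on_cst oT A) smooth_energy). Qed.

Lemma msmooth_pp : msmooth tube_dom (fun z => (p z)^T *m p z).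
Proof. exact: (msmoothM oT (msmooth_tr oT msmooth_cov) msmooth_cov). Qed.

Lemma msmooth_Gh : msmooth tube_dom Gh.
Proof.
apply: (msmooth_eq oT (fun z _ => esym (GhE z))).
apply: (msmoothD oT); apply: (msmoothZ oT).
- exact: smooth_lambda.
- exact: msmooth_gq.
- exact: smooth_kappa.
- exact: msmooth_pp.
Qed.

Lemma msmooth_Hv : msmooth tube_dom Hv.
Proof.
apply: (msmooth_eq oT _ (msmooth_invmx oT Gh_unit msmooth_Gh)) => z Tz.
by rewrite Hv_inv.
Qed.

Lemma dir_lambda x z : tube_dom z ->
  dir x (fun z => A * energy g z) z = A * pair_cov z (ver x z).
Proof.
move=> Tz; rewrite (dirM x (smooth_on_cst oT A) smooth_energy Tz) dir_cst.
by rewrite mul0r add0r dir_energy.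
Qed.

Lemma dir_kappa x z : tube_dom z ->
  dir x (fun z => c * (A * energy g z)^-1 - A) z =
  - (c / (A * energy g z ^+ 2) * pair_cov z (ver x z)).
Proof.
move=> Tz; have sI := smooth_inv_energy; have sc := smooth_on_cst oT c.
rewrite (dirD x (smooth_onM oT sc sI) (smooth_on_cst oT (- A)) Tz) dir_cst.
rewrite addr0.
rewrite (dirM x sc sI Tz) dir_cst mul0r add0r.
rewrite (dirV oT _ _ smooth_lambda Tz) => [|y Ty]; last first.
  by rewrite mulf_neq0 ?gt_eqF//; exact: energy_gt0.
rewrite dir_lambda//; have := lt0r_neq0 (energy_gt0 Tz).
by move: (energy g z) (pair_cov _ _) => t s t0; field; rewrite t0 gt_eqF.
Qed.

(* The first and ([d2Gh] below) second derivatives of [Gh] along the fibre. *)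
Definition dGh (b : 'rV[R]_n) z : 'M[R]_n :=
  locked ((A * pair_cov z b) *: gq z
  + (- (c / (A * energy g z ^+ 2) * pair_cov z b)) *: ((p z)^T *m p z)
  + (c * (A * energy g z)^-1 - A) *: (b^T *m p z + (p z)^T *m b)).

Lemma dGhE b z : dGh b z =
  (A * pair_cov z b) *: gq z
  + (- (c / (A * energy g z ^+ 2) * pair_cov z b)) *: ((p z)^T *m p z)
  + (c * (A * energy g z)^-1 - A) *: (b^T *m p z + (p z)^T *m b).
Proof. by rewrite /dGh -lock. Qed.

Lemma smooth_inv_energy_sq :
  smooth_on tube_dom (fun z => c / (A * energy g z ^+ 2)).
Proof.
apply: (smooth_on_eq oT _ (smooth_onM oT (smooth_onM oT
  (smooth_on_cst oT (c * A)) smooth_inv_energy) smooth_inv_energy)) => z.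
rewrite inE => Tz.
have := lt0r_neq0 (energy_gt0 Tz).
by move: (energy g z) => t t0; field; rewrite t0 gt_eqF.
Qed.

Lemma dir_inv_energy_sq x z : tube_dom z ->
  dir x (fun z => c / (A * energy g z ^+ 2)) z =
  - (2 * c / (A * energy g z ^+ 3) * pair_cov z (ver x z)).
Proof.
move=> Tz; have sI := smooth_inv_energy; have sc := smooth_on_cst oT (c * A).
have E : {in tube_dom, (fun z => c / (A * energy g z ^+ 2)) =1
    (fun z => c * A * (A * energy g z)^-1 * (A * energy g z)^-1)}.
  move=> y; rewrite inE => Ty; have := lt0r_neq0 (energy_gt0 Ty).
  by move: (energy g y) => t t0; field; rewrite t0 gt_eqF.
rewrite (dir_eq_on oT x Tz E) (dirM x (smooth_onM oT sc sI) sI Tz).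
rewrite (dirM x sc sI Tz) dir_cst mul0r add0r.
rewrite (dirV oT _ _ smooth_lambda Tz) => [|y Ty]; last first.
  by rewrite mulf_neq0 ?gt_eqF//; exact: energy_gt0.
rewrite dir_lambda//; have := lt0r_neq0 (energy_gt0 Tz).
by move: (energy g z) (pair_cov _ _) => t s t0; field; rewrite t0 gt_eqF.
Qed.

(** Horizontally g and p are parallel and t is constant, so only the connection acts; the fibre
    component of [x] contributes [dGh]. *)
Lemma mdir_Gh x z : tube_dom z -> mdir x Gh z =
  M (lsubmx x) z *m Gh z + Gh z *m (M (lsubmx x) z)^T + dGh (ver x z) z.
Proof.
move=> Tz; have sl := smooth_lambda; have sk := smooth_kappa.
have sgq' := msmooth_gq; have sp := msmooth_cov; have spp := msmooth_pp.
rewrite (mdir_eq_on oT x Tz (fun z _ => GhE z)).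
rewrite (mdirD x (msmoothZ oT sl sgq') (msmoothZ oT sk spp) Tz).
rewrite (mdirZ x sl sgq' Tz) (mdirZ x sk spp Tz) dir_lambda// dir_kappa//.
rewrite (mdirM oT x (msmooth_tr oT sp) sp Tz) mdir_tr mdir_rsubmx mdir_gq//.
have -> : rsubmx x = ver x z + p z *m (M (lsubmx x) z)^T by rewrite subrK.
rewrite GhE dGhE; move: (ver x z) (M _ z) => b N.
move: (A * pair_cov z b) (- (c / _ * _)) (A * energy g z) (c * _ - A).
move=> r s t k.
rewrite [(b + _)^T]linearD/= trmx_mul trmxK !(mulmxDr, mulmxDl) !scalerDr.
rewrite -!scalemxAl -!scalemxAr !mulmxA.
move: (r *: gq z) (t *: (N *m gq z)) (t *: (gq z *m N^T)) => a1 a2 a3.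
move: (s *: _) (k *: (b^T *m p z)) (k *: (N *m (p z)^T *m p z)) => a4 a5 a6.
move: (k *: ((p z)^T *m b)) (k *: ((p z)^T *m p z *m N^T)) => a7 a8.
by apply/matrixP => i j; rewrite !mxE; ring.
Qed.

Lemma mdir_Hv x z : tube_dom z -> mdir x Hv z =
  - (Hv z *m M (lsubmx x) z + (M (lsubmx x) z)^T *m Hv z
     + Hv z *m dGh (ver x z) z *m Hv z).
Proof.
move=> Tz; rewrite (mdir_eq_on oT x Tz Hv_inv).
rewrite (mdir_invmx oT x Gh_unit msmooth_Gh Tz) -Hv_inv// mdir_Gh//.
congr (- _); apply: mul_inverse_sandwich (Gh_Hv Tz).
Qed.

(** * The tube metric in the adapted frame *)

Lemma mul_Gamma0 (e : 'rV[R]_n) z : e *m Gamma0 g z = p z *m (M e z)^T.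
Proof.
apply/rowP => j; rewrite !mxE.
under eq_bigr do rewrite mxE mulr_sumr.
rewrite exchange_big; apply: eq_bigr => k _; rewrite !mxE mulr_sumr.
by apply: eq_bigr => i _; rewrite mulrCA.
Qed.

Lemma mul_adapted_coframe x z :
  x *m adapted_coframe g z = row_mx (lsubmx x) (ver x z).
Proof.
rewrite -[in LHS](hsubmxK x) mul_row_block !mulmx1 mulmx0 addr0 mulmxN.
by rewrite mul_Gamma0 addrC.
Qed.

(** The inner product of [x] and [y], kept as a 1 x 1 matrix so that the product rule for matrix
    functions applies. *)
Definition Phi x y z : 'M[R]_1 :=
  lsubmx x *m Gh z *m (lsubmx y)^T + ver x z *m Hv z *m (ver y z)^T.

Lemma Phi_tube x y z : tube_dom z ->
  x *m tube_metric_loc c A g z *m y^T = Phi x y z.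
Proof.
move=> Tz; rewrite /tube_metric_loc !mulmxA -mulmxA -trmx_mul.
rewrite !mul_adapted_coframe mul_row_block !mulmx0 addr0 add0r.
by rewrite tr_row_mx mul_row_col -Gh_G_hor// -Hv_H_ver.
Qed.

Lemma inner_tube x y z : tube_dom z ->
  inner (tube_metric_loc c A g) z x y = Phi x y z 0 0.
Proof. by move=> Tz; rewrite /inner Phi_tube. Qed.

Lemma msmooth_Gamma0 : msmooth tube_dom (Gamma0 g).
Proof.
move=> i j; have S := msmoothM oT msmooth_cov
  (msmooth_tr oT (msmooth_Mq (delta_mx 0 i))).
apply: (smooth_on_eq oT) (S 0 j) => z _.
by rewrite -mul_Gamma0 -rowE mxE.
Qed.

Lemma msmooth_tube : msmooth tube_dom (tube_metric_loc c A g).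
Proof.
have sC : msmooth tube_dom (adapted_coframe g).
  apply: (msmooth_block oT); try exact: msmooth_cst.
  exact/(msmoothN oT)/msmooth_Gamma0.
apply: (msmoothM oT); last exact: msmooth_tr.
apply: (msmoothM oT) => //.
apply: (msmooth_block oT); try exact: msmooth_cst.
  by apply: (msmooth_eq oT) msmooth_Gh => z Tz; rewrite Gh_G_hor.
by apply: (msmooth_eq oT) msmooth_Hv => z _; rewrite Hv_H_ver.
Qed.

Lemma tubeT z : tube_dom z ->
  (tube_metric_loc c A g z)^T = tube_metric_loc c A g z.
Proof.
move=> Tz; rewrite /tube_metric_loc 2!trmx_mul trmxK mulmxA.
congr (_ *m _ *m _).
rewrite tr_block_mx !trmx0 -Gh_G_hor// -Hv_H_ver GhT ?HvT//.
exact: tube_domW.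
Qed.

Lemma tube_unit z : tube_dom z -> tube_metric_loc c A g z \in unitmx.
Proof.
move=> Tz; have CF : adapted_coframe g z *m adapted_frame g z = 1%:M.
  rewrite mulmx_block !(mulmx1, mul1mx, mulmx0, mul0mx, addr0, add0r) subrr.
  by rewrite -scalar_mx_block.
have CU : adapted_coframe g z \in unitmx by have [] := mulmx1_unit CF.
rewrite /tube_metric_loc !unitmx_mul unitmx_tr CU andbT /=.
have BB : block_mx (G_hor c A g z) 0 0 (H_ver c A g z) *m
    block_mx (Hv z) 0 0 (Gh z) = 1%:M.
  rewrite mulmx_block !(mulmx0, mul0mx, addr0, add0r) -Gh_G_hor// -Hv_H_ver.
  by rewrite Gh_Hv// (mulmx1C (Gh_Hv Tz)) -scalar_mx_block.
by have [] := mulmx1_unit BB.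
Qed.

Lemma msmooth_ver x : msmooth tube_dom (ver x).
Proof.
apply: (msmoothD oT (msmooth_cst oT _)); apply: (msmoothN oT).
exact: (msmoothM oT msmooth_cov (msmooth_tr oT (msmooth_Mq _))).
Qed.

Lemma mdir_ver y x z : tube_dom z -> mdir y (ver x) z =
  - (rsubmx y *m (M (lsubmx x) z)^T
     + p z *m (mdir (lsubmx y) (conn g (lsubmx x)) (lsubmx z))^T).
Proof.
move=> Tz; have sM := msmooth_Mq (lsubmx x); have sp := msmooth_cov.
have spM := msmoothM oT sp (msmooth_tr oT sM).
rewrite (mdirD y (msmooth_cst oT _) (msmoothN oT spM) Tz) mdir_cst add0r.
rewrite (mdirN y spM Tz) (mdirM oT y sp (msmooth_tr oT sM) Tz).
by rewrite mdir_rsubmx mdir_tr mdir_lsubmx.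
Qed.

Lemma msmooth_dGh (b : 'rV[R]_(n + n) -> 'rV[R]_n) : msmooth tube_dom b ->
  msmooth tube_dom (fun z => dGh (b z) z).
Proof.
move=> sb; have sp := msmooth_cov.
have spair : smooth_on tube_dom (fun z => pair_cov z (b z)).
  exact: (msmoothM oT (msmoothM oT sp msmooth_hq) (msmooth_tr oT sb) 0 0).
apply: (msmooth_eq oT (fun z _ => esym (dGhE (b z) z))).
apply: (msmoothD oT); [apply: (msmoothD oT)|]; apply: (msmoothZ oT).
- exact: (smooth_onM oT (smooth_on_cst oT A) spair).
- exact: msmooth_gq.
- apply: (smooth_onN oT); exact: (smooth_onM oT smooth_inv_energy_sq spair).
- exact: msmooth_pp.
- exact: smooth_kappa.
- apply: (msmoothD oT); apply: (msmoothM oT) => //; exact: msmooth_tr.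
Qed.

Lemma dGhZ a b z : dGh (a *: b) z = a *: dGh b z.
Proof.
have pZ : pair_cov z (a *: b) = a * pair_cov z b.
  by rewrite /pair_cov linearZ/= -scalemxAr mxE.
rewrite !dGhE pZ [(a *: b)^T]linearZ/= -scalemxAl -scalemxAr.
by apply/matrixP => i j; rewrite !mxE; ring.
Qed.

Lemma dGh0 z : dGh 0 z = 0.
Proof. by rewrite -(scale0r 0) dGhZ scale0r. Qed.

(** [dGh] is linear in its vector argument, so where that argument vanishes only its own derivative
    counts. The case of interest is the fibre component of w. *)
Lemma mdir_dGh0 x (b : 'rV[R]_(n + n) -> 'rV[R]_n) z : tube_dom z ->
  msmooth tube_dom b -> b z = 0 ->
  mdir x (fun z => dGh (b z) z) z = dGh (mdir x b z) z.
Proof.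
move=> Tz sb b0.
have sp := msmooth_cov; have sh := msmooth_hq; have sbt := msmooth_tr oT sb.
have sph := msmoothM oT sp sh.
have spair : smooth_on tube_dom (fun z => pair_cov z (b z)).
  exact: (msmoothM oT sph sbt 0 0).
have dpair : dir x (fun z => pair_cov z (b z)) z = pair_cov z (mdir x b z).
  transitivity ((mdir x (fun z => p z *m h z *m (b z)^T) z) 0 0).
    by rewrite mxE.
  by rewrite (mdirM oT x sph sbt Tz) b0 trmx0 mulmx0 add0r mdir_tr.
have pair0 : pair_cov z (b z) = 0 by rewrite /pair_cov b0 trmx0 mulmx0 mxE.
have s1 := smooth_onM oT (smooth_on_cst oT A) spair.
have s2' := smooth_inv_energy_sq.
have s2 := smooth_onN oT (smooth_onM oT s2' spair).
have spp := msmooth_pp; have sgq' := msmooth_gq; have sk := smooth_kappa.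
have S1 := msmoothM oT sbt sp; have S2 := msmoothM oT (msmooth_tr oT sp) sb.
have S3 := msmoothD oT S1 S2.
rewrite (mdir_eq_on oT x Tz (fun z _ => dGhE (b z) z)) [in RHS]dGhE.
rewrite (mdirD x (msmoothD oT (msmoothZ oT s1 sgq') (msmoothZ oT s2 spp))
  (msmoothZ oT sk S3) Tz).
rewrite (mdirD x (msmoothZ oT s1 sgq') (msmoothZ oT s2 spp) Tz).
rewrite (mdirZ x s1 sgq' Tz) (mdirZ x s2 spp Tz) (mdirZ x sk S3 Tz).
rewrite (mdirD x S1 S2 Tz) (mdirM oT x sbt sp Tz).
rewrite (mdirM oT x (msmooth_tr oT sp) sb Tz) !mdir_tr pair0 b0.
rewrite !(trmx0, mul0mx, mulmx0, add0r, addr0, scaler0, mulr0, oppr0, scale0r).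
rewrite (dirM x (smooth_on_cst oT A) spair Tz) dir_cst mul0r add0r.
rewrite (dirN x (smooth_onM oT s2' spair) Tz) (dirM x s2' spair Tz) pair0 mulr0.
by rewrite add0r dpair.
Qed.

Lemma ver_vertical (b : 'rV[R]_n) z : ver (row_mx 0 b) z = b.
Proof. by rewrite /ver /M row_mxKl row_mxKr conn0 trmx0 mulmx0 subr0. Qed.

Lemma mdir_pullback_vertical r s (F : 'rV[R]_n -> 'M[R]_(r, s))
    (b : 'rV[R]_n) z : mdir (row_mx 0 b) (fun y => F (lsubmx y)) z = 0.
Proof. by rewrite mdir_lsubmx row_mxKl mdir0l. Qed.

Definition d2Gh (b : 'rV[R]_n) z : 'M[R]_n :=
  locked (let t := energy g z in
  let s := pair_cov z b in
  let B := (b *m h z *m b^T) 0 0 in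
  (A * B) *: gq z
  + (2 * c / (A * t ^+ 3) * s ^+ 2 - c / (A * t ^+ 2) * B)
    *: ((p z)^T *m p z)
  + (- (2 * c / (A * t ^+ 2) * s)) *: (b^T *m p z + (p z)^T *m b)
  + (c * (A * t)^-1 - A) *: (2 *: (b^T *m b))).

Lemma d2GhE b z : d2Gh b z =
  let t := energy g z in
  let s := pair_cov z b in
  let B := (b *m h z *m b^T) 0 0 in
  (A * B) *: gq z
  + (2 * c / (A * t ^+ 3) * s ^+ 2 - c / (A * t ^+ 2) * B)
    *: ((p z)^T *m p z)
  + (- (2 * c / (A * t ^+ 2) * s)) *: (b^T *m p z + (p z)^T *m b)
  + (c * (A * t)^-1 - A) *: (2 *: (b^T *m b)).
Proof. by rewrite /d2Gh -lock. Qed.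

Lemma mdir_dGh_vertical (b : 'rV[R]_n) z : tube_dom z ->
  mdir (row_mx 0 b) (dGh b) z = d2Gh b z.
Proof.
move=> Tz; set x := row_mx 0 b.
have sp := msmooth_cov; have sh := msmooth_hq.
have sb := msmooth_cst (m := n + n) oT b.
have sbt := msmooth_cst (m := n + n) oT b^T.
have sph := msmoothM oT sp sh.
have spair : smooth_on tube_dom (fun z => pair_cov z b).
  exact: (msmoothM oT sph sbt 0 0).
have dpair : dir x (fun z => pair_cov z b) z = (b *m h z *m b^T) 0 0.
  transitivity ((mdir x (fun z => p z *m h z *m b^T) z) 0 0).
    by rewrite mxE.
  rewrite (mdirM oT x sph sbt Tz) mdir_cst mulmx0 addr0 (mdirM oT x sp sh Tz).
  rewrite mdir_rsubmx row_mxKr (mdir_pullback_vertical (fun u => invmx (g u))).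
  by rewrite mulmx0 addr0.
have s1 := smooth_onM oT (smooth_on_cst oT A) spair.
have s2' := smooth_inv_energy_sq.
have s2 := smooth_onN oT (smooth_onM oT s2' spair).
have spp := msmooth_pp; have sgq' := msmooth_gq; have sk := smooth_kappa.
have S1 := msmoothM oT sbt sp; have S2 := msmoothM oT (msmooth_tr oT sp) sb.
have S3 := msmoothD oT S1 S2.
rewrite (mdir_eq_on oT x Tz (fun z _ => dGhE b z)).
rewrite (mdirD x (msmoothD oT (msmoothZ oT s1 sgq') (msmoothZ oT s2 spp))
  (msmoothZ oT sk S3) Tz).
rewrite (mdirD x (msmoothZ oT s1 sgq') (msmoothZ oT s2 spp) Tz).
rewrite (mdirZ x s1 sgq' Tz) (mdirZ x s2 spp Tz) (mdirZ x sk S3 Tz).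
rewrite (mdirD x S1 S2 Tz) (mdirM oT x sbt sp Tz).
rewrite (mdirM oT x (msmooth_tr oT sp) sb Tz).
rewrite (mdirM oT x (msmooth_tr oT sp) sp Tz).
rewrite (mdir_pullback_vertical g) !mdir_tr !mdir_cst mdir_rsubmx row_mxKr.
rewrite !(trmx0, mul0mx, mulmx0, add0r, addr0, scaler0).
rewrite (dirM x (smooth_on_cst oT A) spair Tz) dir_cst mul0r add0r dpair.
rewrite (dirN x (smooth_onM oT s2' spair) Tz) (dirM x s2' spair Tz) dpair.
rewrite dir_kappa// ver_vertical dir_inv_energy_sq// ver_vertical d2GhE.
have := lt0r_neq0 (energy_gt0 Tz); move: (energy g z) (pair_cov z b) => t s t0.
move: ((b *m h z *m b^T) 0 0) => B; apply/matrixP => i j; rewrite !mxE.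
move: (gq z i j) (\sum_k _) (\sum_k _) (\sum_k _) (\sum_k _) => r1 r2 r3 r4 r5.
by field; rewrite t0 gt_eqF.
Qed.

Lemma mdir_Phi w x y z : tube_dom z ->
  mdir w (Phi x y) z =
  lsubmx x *m (M (lsubmx w) z *m Gh z + Gh z *m (M (lsubmx w) z)^T
               + dGh (ver w z) z) *m (lsubmx y)^T
  + mdir w (ver x) z *m Hv z *m (ver y z)^T
  + ver x z *m Hv z *m (mdir w (ver y) z)^T
  - ver x z *m (Hv z *m M (lsubmx w) z + (M (lsubmx w) z)^T *m Hv z
     + Hv z *m dGh (ver w z) z *m Hv z) *m (ver y z)^T.
Proof.
move=> Tz; have sG := msmooth_Gh; have sH := msmooth_Hv.
have sx := msmooth_ver x; have sy := msmooth_ver y.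
have sc := fun r s (N : 'M[R]_(r, s)) => msmooth_cst (m := n + n) oT N.
have S1 := msmoothM oT (sc _ _ (lsubmx x)) sG.
have S2 := msmoothM oT S1 (sc _ _ (lsubmx y)^T).
have S3 := msmoothM oT sx sH.
have S4 := msmoothM oT S3 (msmooth_tr oT sy).
rewrite (mdirD w S2 S4 Tz) (mdirM oT w S1 (sc _ _ _) Tz) mdir_cst mulmx0 addr0.
rewrite (mdirM oT w (sc _ _ _) sG Tz) mdir_cst mul0mx add0r mdir_Gh//.
rewrite (mdirM oT w S3 (msmooth_tr oT sy) Tz) mdir_tr (mdirM oT w sx sH Tz).
rewrite mdir_Hv// mulmxN mulmxBl -!addrA; congr (_ + (_ + _)).
by rewrite addrC.
Qed.

(** * Second derivatives of the metric on the plane of v and J v *)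

Section HolomorphicPlane.
(* [v] is the vertical lift of [b] and [w] the horizontal lift of [a]; below [a]
   is chosen such that w = J v. *)
Variables (z v w : 'rV[R]_(n + n)) (a b : 'rV[R]_n).
Hypothesis Tz : tube_dom z.
Hypothesis lsub_v : lsubmx v = 0.
Hypothesis rsub_v : rsubmx v = b.
Hypothesis lsub_w : lsubmx w = a.
Hypothesis rsub_w : rsubmx w = p z *m (M a z)^T.

Let H := Hv z.
Let N := M a z.
Let K := mdir a (conn g a) (lsubmx z).
(** Minus the derivative of [ver w] along [w]; through [K] it contains unknown derivatives of the
    connection of g. *)
Let theta : 'rV[R]_n := p z *m (N *m N + K)^T.

Lemma ver_v : ver v = fun=> b.
Proof.
apply/funext => y; rewrite -[v]hsubmxK lsub_v rsub_v; exact: ver_vertical.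
Qed.

Lemma mdir_pullback_v r s (F : 'rV[R]_n -> 'M[R]_(r, s)) y :
  mdir v (fun y => F (lsubmx y)) y = 0.
Proof. by rewrite mdir_lsubmx lsub_v mdir0l. Qed.

Lemma ver_w0 : ver w z = 0.
Proof. by rewrite /ver rsub_w lsub_w subrr. Qed.

Lemma mdir_ver_vw : mdir v (ver w) z = - (b *m N^T).
Proof.
by rewrite (mdir_ver _ _ Tz) lsub_v mdir0l trmx0 mulmx0 addr0 rsub_v lsub_w.
Qed.

Lemma mdir_ver_ww : mdir w (ver w) z = - theta.
Proof.
rewrite (mdir_ver _ _ Tz) lsub_w rsub_w /theta [(N *m N + K)^T]linearD/=.
rewrite trmx_mul.
by rewrite mulmxDr mulmxA.
Qed.

Let sc r s (N' : 'M[R]_(r, s)) := msmooth_cst (m := n + n) oT N'.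

(** [ver w] vanishes at [z] and has derivative - b N^T along [v]. A term still quadratic in [ver w]
    after one differentiation disappears; the two linear ones give equal contributions. *)
Lemma second_vv_ww : mdir v (mdir v (Phi w w)) z =
  a *m d2Gh b z *m a^T + 2 *: (b *m N^T *m H *m N *m b^T).
Proof.
pose F y := a *m dGh b y *m a^T
  + - (b *m (M a y)^T) *m Hv y *m (ver w y)^T
  + (- (b *m (M a y)^T) *m Hv y *m (ver w y)^T)^T
  - ver w y *m (Hv y *m dGh b y *m Hv y) *m (ver w y)^T.
rewrite (mdir_eq_on oT v Tz (H := F)) => [|y Ty]; last first.
  rewrite (mdir_Phi _ _ _ Ty) (mdir_ver _ _ Ty) ver_v lsub_v lsub_w mdir0l.
  rewrite /M conn0 !(trmx0, mulmx0, mul0mx, addr0, add0r) rsub_v /F.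
  congr (_ + _ + _ - _).
  by rewrite !trmx_mul trmxK HvT// mulmxA.
have sdG : msmooth tube_dom (dGh b) by exact: (msmooth_dGh (sc b)).
have sH := msmooth_Hv; have sw := msmooth_ver w; have swt := msmooth_tr oT sw.
have sN : msmooth tube_dom (fun y => - (b *m (M a y)^T)).
  exact: (msmoothN oT (msmoothM oT (sc b) (msmooth_tr oT (msmooth_Mq a)))).
have sNH := msmoothM oT sN sH.
have sQ := msmoothM oT sNH swt.
have sHGH := msmoothM oT (msmoothM oT sH sdG) sH.
have sX := msmoothM oT (msmoothM oT sw sHGH) swt.
have saG := msmoothM oT (sc a) sdG.
have saGa := msmoothM oT saG (sc a^T).
have sQt := msmooth_tr oT sQ; have sGQ := msmoothD oT saGa sQ.
rewrite (mdirD v (msmoothD oT sGQ sQt) (msmoothN oT sX) Tz).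
rewrite (mdirD v sGQ sQt Tz) (mdirD v saGa sQ Tz).
rewrite mdir_tr (mdirN v sX Tz).
rewrite (mdirM oT v saG (sc _) Tz) mdir_cst mulmx0 addr0.
rewrite (mdirM oT v (sc a) sdG Tz) mdir_cst mul0mx add0r.
rewrite -[in mdir v (dGh b)](hsubmxK v) lsub_v rsub_v.
rewrite (mdir_dGh_vertical _ Tz).
rewrite (mdirM oT v sNH swt Tz) mdir_tr.
rewrite (mdirM oT v (msmoothM oT sw sHGH) swt Tz) (mdirM oT v sw sHGH Tz).
rewrite mdir_tr mdir_ver_vw ver_w0.
rewrite !(trmx0, mulmx0, mul0mx, add0r, addr0, subr0).
rewrite -addrA; congr (_ + _); rewrite scalar_tr scaler_nat mulr2n.
by rewrite linearN/= !(mulNmx, mulmxN) opprK trmx_mul trmxK !mulmxA.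
Qed.

Lemma second_vw_vw : mdir v (mdir w (Phi v w)) z =
  b *m (H *m dGh b z *m H) *m theta^T - b *m H *m K *m b^T
  + b *m H *m N *m N *m b^T + b *m N^T *m H *m N *m b^T.
Proof.
(* At a variable point, [X] is the derivative of [ver w] along [w] and [Y] is minus that of [Hv].
   The factor at [z] is frozen because [w] has constant coefficients. *)
pose X y := - (p z *m (M a z)^T *m (M a y)^T
  + p y *m (mdir a (conn g a) (lsubmx y))^T).
pose Y y := Hv y *m M a y + (M a y)^T *m Hv y
  + Hv y *m dGh (ver w y) y *m Hv y.
pose F y := b *m Hv y *m (X y)^T - b *m Y y *m (ver w y)^T.
rewrite (mdir_eq_on oT v Tz (H := F)) => [|y Ty]; last first.
  rewrite (mdir_Phi _ _ _ Ty) ver_v mdir_cst (mdir_ver _ _ Ty).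
  rewrite lsub_v lsub_w rsub_w.
  by rewrite !(mul0mx, add0r).
have sH := msmooth_Hv; have sw := msmooth_ver w; have swt := msmooth_tr oT sw.
have sM := msmooth_Mq a; have sMt := msmooth_tr oT sM.
have sdw := msmooth_dGh sw; have sp := msmooth_cov.
have sK : msmooth tube_dom (fun y => mdir a (conn g a) (lsubmx y)).
  apply: (msmooth_lsubmx oT tube_domW).
  exact/(msmooth_mdir oD)/(msmooth_conn oD sg gU).
have sKt := msmooth_tr oT sK.
have sX1 := msmoothM oT (sc (p z *m (M a z)^T)) sMt.
have sX2 := msmoothM oT sp sKt.
have sX12 := msmoothD oT sX1 sX2.
have sX := msmoothN oT sX12.
have sXt := msmooth_tr oT sX.
have sY := msmoothD oT (msmoothD oT (msmoothM oT sH sM) (msmoothM oT sMt sH))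
  (msmoothM oT (msmoothM oT sH sdw) sH).
have sbH := msmoothM oT (sc b) sH; have sbY := msmoothM oT (sc b) sY.
rewrite (mdirD v (msmoothM oT sbH sXt) (msmoothN oT (msmoothM oT sbY swt)) Tz).
rewrite (mdirN v (msmoothM oT sbY swt) Tz) (mdirM oT v sbH sXt Tz).
rewrite (mdirM oT v sbY swt Tz) !mdir_tr mdir_ver_vw ver_w0 trmx0 mulmx0 add0r.
rewrite (mdirM oT v (sc b) sH Tz) mdir_cst mul0mx add0r (mdir_Hv _ Tz).
rewrite (mdirN v sX12 Tz) (mdirD v sX1 sX2 Tz) (mdirM oT v (sc _) sMt Tz).
rewrite mdir_cst mul0mx add0r (mdirM oT v sp sKt Tz) !mdir_tr.
rewrite (mdir_pullback_v (conn g a)) (mdir_pullback_v (mdir a _)).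
rewrite mdir_rsubmx rsub_v !(trmx0, mulmx0, addr0, add0r) lsub_v /M conn0.
rewrite !(trmx0, mulmx0, mul0mx, addr0, add0r) ver_v.
rewrite dGh0 !(mulmx0, mul0mx, addr0) -/N -/K -/H.
have -> : p z *m N^T *m N^T + p z *m K^T = theta.
  by rewrite /theta [(N *m N + K)^T]linearD/= trmx_mul mulmxDr mulmxA.
rewrite -/N -/H ![(- _)^T]linearN/= !(mulNmx, mulmxN) !opprK.
rewrite [(b *m K^T)^T]trmx_mul trmxK [(b *m N^T)^T]trmx_mul trmxK.
by rewrite !(mulmxDr, mulmxDl) !mulmxA addrA.
Qed.

Lemma second_ww_vv : mdir w (mdir w (Phi v v)) z =
  b *m (H *m N *m N + N^T *m H *m N - H *m K - K^T *m H
        + N^T *m (H *m N + N^T *m H) + H *m dGh theta z *m H) *m b^T.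
Proof.
pose Y y := Hv y *m M a y + (M a y)^T *m Hv y
  + Hv y *m dGh (ver w y) y *m Hv y.
pose F y := - (b *m Y y *m b^T).
rewrite (mdir_eq_on oT w Tz (H := F)) => [|y Ty]; last first.
  rewrite (mdir_Phi _ _ _ Ty) ver_v lsub_v lsub_w !mdir_cst.
  by rewrite !(trmx0, mulmx0, mul0mx, addr0, add0r).
have sH := msmooth_Hv; have sw := msmooth_ver w.
have sM := msmooth_Mq a; have sMt := msmooth_tr oT sM.
have sdw := msmooth_dGh sw.
have sHM := msmoothM oT sH sM; have sMH := msmoothM oT sMt sH.
have sHd := msmoothM oT sH sdw; have sHdH := msmoothM oT sHd sH.
have sY := msmoothD oT (msmoothD oT sHM sMH) sHdH.
have sbY := msmoothM oT (sc b) sY; have sbYb := msmoothM oT sbY (sc b^T).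
rewrite (mdirN w sbYb Tz) (mdirM oT w sbY (sc _) Tz) mdir_cst mulmx0 addr0.
rewrite (mdirM oT w (sc b) sY Tz) mdir_cst mul0mx add0r.
rewrite (mdirD w (msmoothD oT sHM sMH) sHdH Tz) (mdirD w sHM sMH Tz).
rewrite (mdirM oT w sH sM Tz) (mdirM oT w sMt sH Tz) (mdirM oT w sHd sH Tz).
rewrite (mdirM oT w sH sdw Tz) mdir_tr (mdir_Hv _ Tz).
rewrite (mdir_dGh0 _ Tz sw ver_w0).
rewrite (mdir_lsubmx (conn g a)) mdir_ver_ww ver_w0 dGh0 lsub_w.
rewrite -/N -/H -/K !(mulmx0, mul0mx, addr0, add0r).
have -> : dGh (- theta) z = - dGh theta z by rewrite -scaleN1r dGhZ scaleN1r.
rewrite -mulNmx -mulmxN; congr (_ *m _ *m _).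
rewrite !(mulmxN, mulNmx, mulmxDl, mulmxDr, opprD, opprK) !mulmxA.
move: (H *m N *m N) (N^T *m H *m N) (H *m K) (K^T *m H) => m1 m2 m3 m4.
move: (N^T *m N^T *m H) (H *m dGh theta z *m H) => m5 m6.
by apply/matrixP => i j; rewrite !mxE; ring.
Qed.

(** * Covariant derivatives of v and w, and the curvature form *)

Let G := tube_metric_loc c A g.

Lemma dir_inner_tube x y y' t : tube_dom t ->
  dir x (fun u => inner G u y y') t = (mdir x (Phi y y') t) 0 0.
Proof.
move=> Tt; rewrite mxE; apply: (dir_eq_on oT x Tt) => u.
by rewrite inE => Tu; rewrite inner_tube.
Qed.

(** Represents the linear form sending [beta] to a dGh(beta) a^T, that is, the fibre derivative of
    the squared length of [a]. *)
Definition eta : 'rV[R]_n :=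
  locked ((A * (a *m gq z *m a^T) 0 0
   - c / (A * energy g z ^+ 2) * (a *m (p z)^T) 0 0 ^+ 2) *: (p z *m h z)
  + (2 * (c * (A * energy g z)^-1 - A) * (a *m (p z)^T) 0 0) *: a).

Lemma etaE : eta =
  (A * (a *m gq z *m a^T) 0 0
   - c / (A * energy g z ^+ 2) * (a *m (p z)^T) 0 0 ^+ 2) *: (p z *m h z)
  + (2 * (c * (A * energy g z)^-1 - A) * (a *m (p z)^T) 0 0) *: a.
Proof. by rewrite /eta -lock. Qed.

Lemma eta_dGh beta : (a *m dGh beta z *m a^T) 0 0 = (eta *m beta^T) 0 0.
Proof.
rewrite dGhE etaE !(mulmxDr, mulmxDl) -!(scalemxAl, scalemxAr).
rewrite !(mx11D, mx11Z) -/(pair_cov z beta).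
have E (x y : 'rV[R]_n) :
    (a *m (x^T *m y) *m a^T) 0 0 = (a *m x^T) 0 0 * (a *m y^T) 0 0.
  by rewrite mx11_outer [(y *m a^T) 0 0]mx11_trmul.
rewrite mulmxDr mulmxDl mx11D !E.
move: (pair_cov z beta) (_ 0 0) (_ 0 0) (_ 0 0) => r1 r2 r3 r4.
ring.
Qed.

Hypothesis a_def : a = - (b *m H).

Lemma bH_a : b *m H = - a. Proof. by rewrite a_def opprK. Qed.

Lemma Hb_a : H *m b^T = - a^T.
Proof.
by rewrite -[LHS]trmxK trmx_mul trmxK /H (HvT Tz) -/H bH_a linearN.
Qed.

Lemma mul_Hb r (x : 'M[R]_(r, n)) : x *m H *m b^T = - (x *m a^T).
Proof. by rewrite -mulmxA Hb_a mulmxN. Qed.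

Lemma koszul_tube x y Y : inner G z (y *m conn G x z) Y = 2^-1 *
  ((mdir x (Phi y Y) z) 0 0 + (mdir y (Phi x Y) z) 0 0
   - (mdir Y (Phi x y) z) 0 0).
Proof.
rewrite (koszul oT msmooth_tube tubeT tube_unit x y Y Tz).
by rewrite !(dir_inner_tube _ _ _ Tz).
Qed.

Definition gamma_vv_ver : 'rV[R]_n :=
  (a *m dGh b z *m H + 2^-1 *: eta) *m Gh z.

Lemma gamma_vv_ver_H : gamma_vv_ver *m H = a *m dGh b z *m H + 2^-1 *: eta.
Proof. by rewrite /gamma_vv_ver -mulmxA (Gh_Hv Tz) mulmx1. Qed.

(** In Koszul's formula the terms with the base component of the test vector cancel, so nabla_v v is
    vertical; nondegeneracy then identifies it. *)
Lemma gamma_vv : v *m conn G v z = row_mx 0 gamma_vv_ver.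
Proof.
apply: (inner_inj (tube_unit Tz)) => Y; rewrite koszul_tube inner_tube//.
have E1 : mdir v (Phi v Y) z =
    a *m M (lsubmx Y) z *m b^T + a *m dGh b z *m H *m (ver Y z)^T.
  rewrite (mdir_Phi _ _ _ Tz) ver_v lsub_v mdir_cst [M 0 z]conn0 trmx0.
  rewrite !(mulmx0, mul0mx, addr0, add0r) (mdir_ver _ _ Tz) lsub_v mdir0l.
  rewrite rsub_v trmx0 mulmx0 addr0 linearN/= trmx_mul trmxK.
  rewrite -/H bH_a !mulmxA bH_a !mulNmx mulmxN opprK.
  by rewrite !mulmxA opprK.
have E2 : (mdir Y (Phi v v) z) 0 0 =
    2 * (a *m M (lsubmx Y) z *m b^T) 0 0 - (eta *m (ver Y z)^T) 0 0.
  rewrite (mdir_Phi _ _ _ Tz) ver_v lsub_v mdir_cst trmx0.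
  rewrite !(mulmx0, mul0mx, addr0, add0r) -/H !mulmxDr !mulmxDl !mulmxA.
  rewrite bH_a !mul_Hb.
  rewrite !(mulNmx, mulmxN) -eta_dGh !(mx11N, mx11D) opprK.
  by rewrite [(b *m _ *m a^T) 0 0]mx11_form trmxK; ring.
rewrite E1 E2 /Phi row_mxKl ver_vertical mul0mx mul0mx add0r -/H gamma_vv_ver_H.
rewrite mulmxDl -scalemxAl !mx11D mx11Z.
by field.
Qed.

(** Koszul's formula is needed for a vertical test vector only, so no formula for nabla_w w itself
    is required. *)
Lemma inner_ww_vv : inner G z (w *m conn G w z) (v *m conn G v z) =
  - ((a *m dGh b z *m H + 2^-1 *: eta) *m theta^T) 0 0
  - 2^-1 * (eta *m gamma_vv_ver^T) 0 0.
Proof.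
have lV : lsubmx (row_mx 0 gamma_vv_ver : 'rV[R]_(n + n)) = 0.
  exact: row_mxKl.
have vV : ver (row_mx 0 gamma_vv_ver) z = gamma_vv_ver.
  exact: ver_vertical.
rewrite gamma_vv koszul_tube; move: (row_mx 0 gamma_vv_ver) lV vV => V lV vV.
have E1 : mdir w (Phi w V) z = - (theta *m H *m gamma_vv_ver^T).
  rewrite (mdir_Phi _ _ _ Tz) ver_w0 lV vV mdir_ver_ww trmx0 mulmx0 add0r.
  by rewrite mul0mx mul0mx mul0mx mul0mx addr0 subr0 !mulNmx.
have E2 : mdir V (Phi w w) z = a *m dGh gamma_vv_ver z *m a^T.
  rewrite (mdir_Phi _ _ _ Tz) ver_w0 lV vV trmx0 mulmx0 mul0mx mul0mx mul0mx.
  rewrite mul0mx !addr0 subr0 [M 0 z]conn0 trmx0 mul0mx mulmx0 !add0r.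
  by rewrite lsub_w.
rewrite E1 E2 eta_dGh mx11N [(theta *m H *m _) 0 0]mx11_form.
rewrite [H^T](HvT Tz) -/H gamma_vv_ver_H; by field.
Qed.

(** Twice the base component of nabla_v w, with its index lowered by [Gh]. The term in [c] is R(.,
    a) a for g, paired with p. *)
Definition rho : 'rV[R]_n := locked (a *m dGh b z
  - c *: ((a *m gq z *m a^T) 0 0 *: p z - (a *m (p z)^T) 0 0 *: (a *m gq z))).

Lemma rhoE : rho = a *m dGh b z
  - c *: ((a *m gq z *m a^T) 0 0 *: p z - (a *m (p z)^T) 0 0 *: (a *m gq z)).
Proof. by rewrite /rho -lock. Qed.

Hypothesis base_curvature : forall e : 'rV[R]_n,
  (a *m rmat g e a (lsubmx z) *m (p z)^T) 0 0 =
  c * ((e *m (p z)^T) 0 0 * (a *m gq z *m a^T) 0 0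
       - (e *m gq z *m a^T) 0 0 * (a *m (p z)^T) 0 0).

Definition gamma_vw_hor : 'rV[R]_n := 2^-1 *: (rho *m H).

(** The derivatives [Ka] and [Ke] of the connection combine with the products of [N] and [M e] to
    R(e, a) a paired with p; here the constant curvature of g enters. *)
Lemma gamma_vw : v *m conn G w z = row_mx gamma_vw_hor
  (- (b *m N^T) + p z *m (M gamma_vw_hor z)^T).
Proof.
apply: (inner_inj (tube_unit Tz)) => Y; rewrite koszul_tube inner_tube//.
set e := lsubmx Y; set y := ver Y z.
have yE : rsubmx Y = y + p z *m (M e z)^T by rewrite subrK.
pose Ke := mdir a (conn g e) (lsubmx z).
pose Ka := mdir e (conn g a) (lsubmx z).
have E1 : mdir w (Phi v Y) z = a *m (M e z *m N + Ke) *m (p z)^T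
    + a *m N *m y^T - b *m N^T *m H *m y^T.
  rewrite (mdir_Phi _ _ _ Tz) ver_v lsub_v mdir_cst ver_w0 dGh0 mul0mx mul0mx.
  rewrite mul0mx mul0mx mulmx0 mul0mx !addr0 !add0r lsub_w -/N -/H -/y bH_a.
  rewrite (mdir_ver _ _ Tz) lsub_w rsub_w -/e -/Ke -/N.
  rewrite [(- (_ + _))^T]linearN/= [(_ + p z *m _)^T]linearD/= !trmx_mul !trmxK.
  rewrite mulmxDr mulmxDl !mulmxA bH_a mulNmx mulmxN opprK opprD !mulNmx opprK.
  by rewrite addrA !mulmxDr mulmxDl !mulmxA.
have E2 : mdir v (Phi w Y) z = a *m dGh b z *m e^T - b *m N^T *m H *m y^T.
  rewrite (mdir_Phi _ _ _ Tz) ver_v lsub_v ver_w0 mdir_ver_vw.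
  rewrite mul0mx mul0mx mul0mx mul0mx addr0 subr0 [M 0 z]conn0 trmx0 mul0mx.
  rewrite mulmx0 !add0r lsub_w.
  by rewrite !mulNmx.
have E3 : (mdir Y (Phi w v) z) 0 0 = (a *m N *m y^T) 0 0
    + (a *m (N *m M e z + Ka) *m (p z)^T) 0 0.
  rewrite (mdir_Phi _ _ _ Tz) ver_v lsub_v ver_w0 mdir_cst trmx0 mulmx0.
  rewrite !mul0mx addr0 subr0 add0r (mdir_ver _ _ Tz) lsub_w.
  rewrite -/e -/Ka -/N -/H yE mul_Hb mulNmx opprK mx11_trmul -mx11D.
  rewrite [(_ + p z *m Ka^T)^T]linearD/= !trmx_mul !trmxK.
  rewrite [(y + _)^T]linearD/= trmx_mul trmxK !(mulmxDr, mulmxDl) !mulmxA.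
  by rewrite !mx11D addrA.
rewrite E1 E2 E3 /Phi row_mxKl [ver (row_mx _ _) z]/ver row_mxKl row_mxKr addrK.
rewrite -/e -/y -/H /gamma_vw_hor -!scalemxAl -[rho *m H *m _]mulmxA.
rewrite (mulmx1C (Gh_Hv Tz)) mulmx1 rhoE.
have := base_curvature e; rewrite /rmat -/Ke -/Ka -/N -/(M e z).
rewrite !(mulmxDr, mulmxDl, mulmxN, mulNmx) !(mx11D, mx11N) => HR.
rewrite -!scalemxAl mulmxDl !mulNmx -!scalemxAl !(mx11Z, mx11N, mx11D).
rewrite [(e *m gq z *m a^T) 0 0]mx11_form [(gq z)^T](gT (tube_domW Tz)) in HR.
rewrite [(p z *m e^T) 0 0]mx11_trmul.
transitivity (2^-1 * ((a *m dGh b z *m e^T) 0 0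
    - ((a *m Ka *m (p z)^T) 0 0 - (a *m Ke *m (p z)^T) 0 0
       + (a *m (N *m M e z) *m (p z)^T) 0 0
       - (a *m (M e z *m N) *m (p z)^T) 0 0))
    - (b *m N^T *m H *m y^T) 0 0); first by field.
by rewrite HR; field.
Qed.

Lemma dir2_inner_tube x x' y y' :
  dir x (dir x' (fun u => inner G u y y')) z =
  (mdir x (mdir x' (Phi y y')) z) 0 0.
Proof.
rewrite mxE; apply: (dir_eq_on oT x Tz) => u; rewrite inE => Tu.
exact: dir_inner_tube.
Qed.

Lemma inner_vw_vw : inner G z (v *m conn G w z) (v *m conn G w z) =
  4^-1 * (rho *m H *m rho^T) 0 0 + (b *m N^T *m H *m N *m b^T) 0 0.
Proof.
rewrite gamma_vw inner_tube// /Phi row_mxKl.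
rewrite [ver (row_mx _ _) z]/ver row_mxKl row_mxKr addrK -/H /gamma_vw_hor.
rewrite -!scalemxAl linearZ/= -scalemxAr -[rho *m H *m _]mulmxA.
rewrite (mulmx1C (Gh_Hv Tz)) mulmx1 scalerA [(rho *m H)^T]trmx_mul.
rewrite [H^T](HvT Tz) -/H [(- _)^T]linearN/= mulmxN !mulNmx opprK.
rewrite [(b *m N^T)^T]trmx_mul trmxK mx11D mx11Z !mulmxA.
by congr (_ * _ + _); field.
Qed.

(** Over plain variables, so that the large terms are exchanged at once without matching inside
    them. *)
Lemma substitute_terms (x x1 x2 x3 x4 x5 x6 y1 y2 y3 y4 y5 y6 : R) :
  x = 2^-1 * (x1 + x2 - x3 - x4) - x5 + x6 ->
  x1 = y1 -> x2 = y2 -> x3 = y3 -> x4 = y4 -> x5 = y5 -> x6 = y6 ->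
  x = 2^-1 * (y1 + y2 - y3 - y4) - y5 + y6.
Proof. by move=> -> -> -> -> -> -> ->. Qed.

(** [theta] cancels against <nabla_w w, nabla_v v>, the terms in [K] and [N *m N] cancel among the
    second derivatives, and b N^T H N b^T cancels against its occurrence in |nabla_v w|^2. *)
Lemma holomorphic_curvature_form : inner G z (curvature_op G z v w) v =
  4^-1 * (rho *m H *m rho^T) 0 0 + 2^-1 * (eta *m gamma_vv_ver^T) 0 0
  - 2^-1 * (a *m d2Gh b z *m a^T) 0 0.
Proof.
have sPhi := smooth_inner oT msmooth_tube v w.
have entry (M1 M2 : 'M[R]_1) : M1 = M2 -> M1 0 0 = M2 0 0 by move=> ->.
have E0 := inner_curvature_expanded oT msmooth_tube tubeT tube_unit v w v Tz.
have T1 := etrans (dir2_innerC oT tubeT v w w v Tz)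
  (etrans (dir2_inner_tube v w v w) (entry _ _ second_vw_vw)).
have T2 := etrans (dirC oT w v sPhi Tz)
  (etrans (dir2_inner_tube v w v w) (entry _ _ second_vw_vw)).
have T3 := etrans (dir2_inner_tube v v w w) (entry _ _ second_vv_ww).
have T4 := etrans (dir2_inner_tube w w v v) (entry _ _ second_ww_vv).
rewrite (substitute_terms E0 T1 T2 T3 T4 inner_ww_vv inner_vw_vw).
move=> {E0 T1 T2 T3 T4}.
have E1 : (b *m (H *m dGh b z *m H) *m theta^T - b *m H *m K *m b^T
    + b *m H *m N *m N *m b^T + b *m N^T *m H *m N *m b^T) 0 0 =
    - (a *m dGh b z *m H *m theta^T) 0 0 + (a *m K *m b^T) 0 0
    - (a *m N *m N *m b^T) 0 0 + (b *m N^T *m H *m N *m b^T) 0 0.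
  by rewrite !mulmxA bH_a !mulNmx !(mx11D, mx11N) opprK.
have E2 : (b *m (H *m N *m N + N^T *m H *m N - H *m K - K^T *m H
        + N^T *m (H *m N + N^T *m H) + H *m dGh theta z *m H) *m b^T) 0 0 =
    - (2 * (a *m N *m N *m b^T) 0 0) + 2 * (b *m N^T *m H *m N *m b^T) 0 0
    + 2 * (a *m K *m b^T) 0 0 + (eta *m theta^T) 0 0.
  rewrite -eta_dGh.
  move: (dGh theta z) => d; move: bH_a mul_Hb.
  move: (H) (N) (K) => H' N' K' e1 e2.
  rewrite !mulmxDr !mulmxDl !mulmxN !mulNmx !mulmxA.
  rewrite !e2 e1 !mulNmx !(mx11D, mx11N).
  rewrite [(b *m K'^T *m _) 0 0]mx11_form trmxK.
  rewrite -[b *m N'^T *m N'^T]mulmxA -trmx_mul [(b *m _ *m a^T) 0 0]mx11_form.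
  rewrite trmxK !mulmxA.
  by ring.
rewrite E1 E2 mx11D mx11Z mulmxDl mx11D -scalemxAl mx11Z.
by field.
Qed.

(** * Evaluation in the span of p and b *)

Let t := energy g z.
Let s := pair_cov z b.
Let B := (b *m h z *m b^T) 0 0.
Let d := 2 * c - A ^+ 2 * t.
Let mu := (A * t)^-1.
Let nu := (c - A ^+ 2 * t) / (A * t ^+ 2 * d).
Let kappa := c * (A * t)^-1 - A.

Lemma hform_sym (x y : 'rV[R]_n) :
  (x *m h z *m y^T) 0 0 = (y *m h z *m x^T) 0 0.
Proof. by rewrite mx11_form (hqT (tube_domW Tz)). Qed.

Lemma pair_cov_p : (p z *m h z *m (p z)^T) 0 0 = 2 * t.
Proof. by rewrite -cov_sqnormE /t /energy mulVKf ?pnatr_eq0. Qed.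

(** The Gram matrix of [p] and [b] has entries 2 t, s, B; it reduces every remaining pairing to
    scalars, since [rho], and [a] and [eta] up to raising the index, are combinations of [p] and
    [b]. *)
Lemma hform (x1 x2 y1 y2 : R) :
  ((x1 *: p z + x2 *: b) *m h z *m (y1 *: p z + y2 *: b)^T) 0 0 =
  2 * t * x1 * y1 + s * (x1 * y2 + x2 * y1) + B * x2 * y2.
Proof.
rewrite linearD !linearZ/= !(mulmxDr, mulmxDl) -!(scalemxAl, scalemxAr).
rewrite !(mx11D, mx11Z) pair_cov_p [(b *m h z *m (p z)^T) 0 0]hform_sym.
by rewrite -/(pair_cov z b) -/s -/B; ring.
Qed.

Lemma pair_cov_span (x1 x2 : R) :
  pair_cov z (x1 *: p z + x2 *: b) = 2 * t * x1 + s * x2.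
Proof.
have := hform 1 0 x1 x2; rewrite scale1r scale0r addr0 -/(pair_cov z _) => ->.
by ring.
Qed.

Lemma Hform (x y : 'rV[R]_n) : (x *m H *m y^T) 0 0 =
  mu * (x *m h z *m y^T) 0 0 - nu * (pair_cov z x * pair_cov z y).
Proof.
rewrite /H HvE mulmxBr mulmxBl -!(scalemxAr, scalemxAl) mx11D mx11N !mx11Z.
by rewrite mx11_outer [(x *m (p z *m h z)^T) 0 0]mx11_trmul.
Qed.

Lemma Gform (x y : 'rV[R]_n) :
  (x *m h z *m Gh z *m (y *m h z)^T) 0 0 =
  A * t * (x *m h z *m y^T) 0 0 + kappa * (pair_cov z x * pair_cov z y).
Proof.
have gzU := gU (tube_domW Tz); have hT := hqT (tube_domW Tz).
rewrite GhE mulmxDr mulmxDl -!(scalemxAr, scalemxAl) mx11D !mx11Z.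
rewrite mx11_outer (mulmxKV gzU) trmx_mul hT !mulmxA.
by rewrite [(x *m h z *m (p z)^T) 0 0]hform_sym.
Qed.

Lemma a_span : a = (nu * s *: p z + (- mu) *: b) *m h z.
Proof.
rewrite a_def /H HvE mulmxBr -!scalemxAr opprB mulmxDl -!scalemxAl scaleNr.
by rewrite mul_outer [(b *m _) 0 0]mx11_trmul scalerA.
Qed.

Lemma a_mul (x1 x2 : R) : (a *m (x1 *: p z + x2 *: b)^T) 0 0 =
  2 * t * (nu * s) * x1 + s * (nu * s * x2 - mu * x1) - B * mu * x2.
Proof. by rewrite a_span hform; ring. Qed.

Let sigma := 2 * t * (nu * s) - s * mu.
Let omega := s * (nu * s) - B * mu.
Let a2 := 2 * t * (nu * s) ^+ 2 - 2 * s * (nu * s * mu) + B * mu ^+ 2.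

Lemma a_mul_p : (a *m (p z)^T) 0 0 = sigma.
Proof.
have := a_mul 1 0; rewrite scale1r scale0r addr0 => ->.
by rewrite /sigma; ring.
Qed.

Lemma a_mul_b : (a *m b^T) 0 0 = omega.
Proof.
have := a_mul 0 1; rewrite scale1r scale0r add0r => ->.
by rewrite /omega; ring.
Qed.

Lemma a_gq : a *m gq z = nu * s *: p z + (- mu) *: b.
Proof. by rewrite a_span (mulmxKV (gU (tube_domW Tz))). Qed.

Lemma a_norm : (a *m gq z *m a^T) 0 0 = a2.
Proof. by rewrite a_gq mx11_trmul a_mul /a2; ring. Qed.

Let X1 := A * s * (nu * s) - c / (A * t ^+ 2) * s * sigma + kappa * omega.
Let X2 := kappa * sigma - A * s * mu.

Lemma a_dGh : a *m dGh b z = X1 *: p z + X2 *: b.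
Proof.
rewrite dGhE !mulmxDr -!scalemxAr mulmxDr !mul_outer a_gq a_mul_p a_mul_b.
rewrite -/s -/t -/kappa /X1 /X2.
by apply/rowP => j; rewrite !mxE; ring.
Qed.

Lemma rho_span :
  rho = (X1 - c * (a2 - sigma * (nu * s))) *: p z
        + (X2 - c * (sigma * mu)) *: b.
Proof.
rewrite rhoE a_dGh a_norm a_mul_p a_gq.
by apply/rowP => j; rewrite !mxE; ring.
Qed.

Let Y1 := A * a2 - c / (A * t ^+ 2) * sigma ^+ 2 + 2 * kappa * sigma * (nu * s).
Let Y2 := - (2 * kappa * sigma * mu).

Lemma eta_span : eta = (Y1 *: p z + Y2 *: b) *m h z.
Proof.
rewrite etaE a_norm a_mul_p a_span -/t -/kappa scalemxAl.
rewrite [in X in _ + X]scalemxAl.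
rewrite -mulmxDl; congr (_ *m _).
by rewrite /Y1 /Y2; apply/rowP => j; rewrite !mxE; ring.
Qed.

Lemma eta_gamma : (eta *m gamma_vv_ver^T) 0 0 =
  2 * t * X1 * Y1 + s * (X1 * Y2 + X2 * Y1) + B * X2 * Y2
  + 2^-1 * (A * t * (2 * t * Y1 * Y1 + s * (Y1 * Y2 + Y2 * Y1) + B * Y2 * Y2)
            + kappa * ((2 * t * Y1 + s * Y2) * (2 * t * Y1 + s * Y2))).
Proof.
rewrite /gamma_vv_ver mulmxDl -[a *m dGh b z *m H *m Gh z]mulmxA.
rewrite (mulmx1C (Gh_Hv Tz)) mulmx1 linearD/= mulmxDr mx11D -scalemxAl.
rewrite linearZ/= -scalemxAr mx11Z; congr (_ + _ * _).
  rewrite mx11_trmul a_dGh eta_span trmx_mul (hqT (tube_domW Tz)).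
  by rewrite mulmxA hform.
rewrite trmx_mul (GhT (tube_domW Tz)) mulmxA eta_span.
by rewrite Gform hform !pair_cov_span.
Qed.

Lemma rho_norm : (rho *m H *m rho^T) 0 0 =
  let x := X1 - c * (a2 - sigma * (nu * s)) in
  let y := X2 - c * (sigma * mu) in
  mu * (2 * t * x * x + s * (x * y + y * x) + B * y * y)
  - nu * ((2 * t * x + s * y) * (2 * t * x + s * y)).
Proof. by rewrite Hform rho_span hform !pair_cov_span. Qed.

Lemma a_d2Gh : (a *m d2Gh b z *m a^T) 0 0 =
  A * B * a2
  + (2 * c / (A * t ^+ 3) * s ^+ 2 - c / (A * t ^+ 2) * B) * sigma ^+ 2
  - 4 * c / (A * t ^+ 2) * s * sigma * omega + 2 * kappa * omega ^+ 2.
Proof.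
rewrite d2GhE /= -/t -/s -/B -/kappa !mulmxDr -!scalemxAr mulmxDr !mul_outer.
rewrite !mulmxDl -!scalemxAl mulmxDl -!scalemxAl !(mx11D, mx11Z) a_norm.
rewrite [(p z *m a^T) 0 0]mx11_trmul [(b *m a^T) 0 0]mx11_trmul a_mul_p a_mul_b.
by ring.
Qed.

Lemma ver_norm : (b *m H *m b^T) 0 0 = mu * B - nu * s ^+ 2.
Proof. by rewrite Hform -/B -/s expr2. Qed.

(** Separates the part of [b] orthogonal to [p] from the radial part, by mu / (2 t) - nu = A / (2 t
    d). In this form positivity is visible. *)
Lemma ver_norm_split : (b *m H *m b^T) 0 0 =
  (B - s ^+ 2 / (2 * t)) / (A * t) + A * s ^+ 2 / (2 * t * d).
Proof.
rewrite ver_norm; have := lt0r_neq0 (energy_gt0 Tz).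
have := lt0r_neq0 (energy_lt Tz); rewrite -/t -/d /nu /mu.
move: t s B @d => t' s' B' /= d0 t0.
by field; rewrite t0 d0 gt_eqF.
Qed.

(** An identity of rational functions of A, c, t, s and B whose denominators are nonzero because A,
    t and d are. *)
Lemma holomorphic_curvature_value : inner G z (curvature_op G z v w) v =
  A / 2 * (b *m H *m b^T) 0 0 ^+ 2
  + A * s ^+ 2 * (B - s ^+ 2 / (2 * t)) / (t ^+ 2 * d).
Proof.
rewrite holomorphic_curvature_form eta_gamma rho_norm a_d2Gh ver_norm.
have := lt0r_neq0 (energy_gt0 Tz); have := lt0r_neq0 (energy_lt Tz).
rewrite -/t /= /Y1 /Y2 /X1 /X2 /a2 /omega /sigma /kappa /nu /mu /d.
move: t s B => t' s' B' d0 t0.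
by field; rewrite t0 d0 gt_eqF.
Qed.

End HolomorphicPlane.

(** * Holomorphic sectional curvatures at one point of the tube *)

Hypothesis g_pos : forall u, D u ->
  forall e : 'rV[R]_n, e != 0 -> 0 < (e *m g u *m e^T) 0 0.
Hypothesis g_curv : forall u, D u -> forall e e' : 'rV[R]_n,
  row_free (col_mx e e') -> sectional_curvature g u e e' = c.

(** Pairing a vector with [p] is taking its inner product with the raised covector [p z *m h z]. *)
Lemma base_curvature_tube z (a e : 'rV[R]_n) : tube_dom z ->
  (a *m rmat g e a (lsubmx z) *m (p z)^T) 0 0 =
  c * ((e *m (p z)^T) 0 0 * (a *m gq z *m a^T) 0 0
       - (e *m gq z *m a^T) 0 0 * (a *m (p z)^T) 0 0).
Proof.
move=> Tz; have Dz := tube_domW Tz; have gzU := gU Dz.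
have := constant_curvature_jacobi oD sg gT gU Dz (lt0r_neq0 c_gt0) (g_curv Dz)
  e a (p z *m h z).
rewrite (curvature_opE oD sg gU e a Dz) /inner trmx_mul (hqT Dz) !mulmxA.
by rewrite !(mulmxK gzU).
Qed.

Lemma tube_complex_structure_vertical z (b : 'rV[R]_n) : tube_dom z ->
  let a := - (b *m Hv z) in
  row_mx 0 b *m tube_complex_structure_loc c A g z =
  row_mx a (p z *m (M a z)^T).
Proof.
move=> Tz a; rewrite /tube_complex_structure_loc !mulmxA mul_adapted_coframe.
rewrite row_mxKl ver_vertical mul_row_block !mulmx0 mul0mx addr0 add0r.
rewrite mul_row_block !mulmx1 mulmx0 !addr0 mulmxN -Hv_H_ver.
by rewrite -/a mul_Gamma0.
Qed.

Lemma holomorphic_sectional_curvature z (b : 'rV[R]_n) : tube_dom z ->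
  let t := energy g z in
  let s := pair_cov z b in
  let W := (b *m h z *m b^T) 0 0 - s ^+ 2 / (2 * t) in
  let d := 2 * c - A ^+ 2 * t in
  let V := W / (A * t) + A * s ^+ 2 / (2 * t * d) in
  sectional_curvature (tube_metric_loc c A g) z (row_mx 0 b)
    (row_mx 0 b *m tube_complex_structure_loc c A g z) =
  (A / 2 * V ^+ 2 + A * s ^+ 2 * W / (t ^+ 2 * d)) / V ^+ 2.
Proof.
move=> Tz t s W d V; rewrite tube_complex_structure_vertical//.
set a := - (b *m Hv z).
have VE : (b *m Hv z *m b^T) 0 0 = V by rewrite ver_norm_split.
have lv : lsubmx (row_mx 0 b : 'rV[R]_(n + n)) = 0 by exact: row_mxKl.
have rv : rsubmx (row_mx 0 b : 'rV[R]_(n + n)) = b by exact: row_mxKr.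
have lw : lsubmx (row_mx a (p z *m (M a z)^T)) = a by exact: row_mxKl.
have rw : rsubmx (row_mx a (p z *m (M a z)^T)) = p z *m (M a z)^T.
  exact: row_mxKr.
have vv : ver (row_mx 0 b) z = b by exact: ver_vertical.
have vw : ver (row_mx a (p z *m (M a z)^T)) z = 0 by rewrite /ver lw rw subrr.
rewrite /sectional_curvature.
rewrite (holomorphic_curvature_value Tz lv rv lw rw erefl); last first.
  by move=> e; exact: base_curvature_tube.
rewrite !inner_tube//.
move: (row_mx 0 b) (row_mx a _) lv vv lw vw {rv rw} => v w lv vv lw vw.
rewrite /Phi lv lw vv vw trmx0 !(mulmx0, mul0mx, addr0, add0r) VE.
(* [Gh] undoes [Hv] in [a], so J v has the length of v; as the two are orthogonal, the Gram
   determinant is V^2. *)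
have -> : (a *m Gh z *m a^T) 0 0 = V.
  rewrite /a mulNmx -[b *m Hv z *m _]mulmxA (mulmx1C (Gh_Hv Tz)) mulmx1.
  by rewrite linearN/= mulNmx mulmxN opprK trmx_mul (HvT Tz) mulmxA VE.
by rewrite [(0 : 'M[R]_1) 0 0]mxE expr0n/= subr0 -expr2.
Qed.

Lemma hq_unit z : D (lsubmx z) -> h z \in unitmx.
Proof. by move=> Dz; rewrite unitmx_inv gU. Qed.

Lemma hq_pos z (e : 'rV[R]_n) : D (lsubmx z) -> e != 0 ->
  0 < (e *m h z *m e^T) 0 0.
Proof.
move=> Dz e0; have gzU := gU Dz.
have eh0 : e *m h z != 0.
  apply: contra_neq e0 => eh0; rewrite -[e](mulmxK (hq_unit Dz)).
  by rewrite eh0 mul0mx.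
have := g_pos Dz eh0; rewrite -[e *m h z *m _]mulmxA (mulVmx gzU) mulmx1.
by rewrite trmx_mul (hqT Dz) mulmxA.
Qed.

Lemma holomorphic_curvature_not_constant z (k : R) : tube_dom z -> (2 <= n)%N ->
  ~ forall v : 'rV[R]_(n + n), v != 0 ->
    sectional_curvature (tube_metric_loc c A g) z v
      (v *m tube_complex_structure_loc c A g z) = k.
Proof.
move=> Tz n2 sec; have Dz := tube_domW Tz.
have t0 := energy_gt0 Tz; have d0 := energy_lt Tz.
have pp : (p z *m h z *m (p z)^T) 0 0 = 2 * energy g z.
  by rewrite -cov_sqnormE /energy mulVKf ?pnatr_eq0.
have p0 : p z != 0.
  apply: contraTneq t0 => p0; rewrite -leNgt.
  have := pp; rewrite p0 trmx0 mulmx0 [in LHS]mxE => /esym/eqP.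
  by rewrite mulf_eq0 pnatr_eq0 /= => /eqP ->.
have [b [s0 W0]] := exists_oblique n2 (hqT Dz) (fun e => hq_pos Dz (e := e)) p0.
rewrite pp in W0.
have row0 (e : 'rV[R]_n) : e != 0 -> row_mx 0 e != 0 :> 'rV[R]_(n + n).
  by apply: contra_neq => /(congr1 (@rsubmx R 1 n n)); rewrite row_mxKr linear0.
have b0 : b != 0.
  by apply: contra_neq s0 => ->; rewrite trmx0 mulmx0 mxE.
apply: (curvature_values_differ A_gt0 t0 d0 W0 s0 _
  (etrans _ (sec _ (row0 _ b0)))).
  have := sec _ (row0 _ p0); rewrite (holomorphic_sectional_curvature _ Tz).
  rewrite /pair_cov pp => <-; set x := 2 * energy g z.
  (* For b = p there is no part orthogonal to [p], so the excess over A / 2 vanishes. *)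
  have -> : x - x ^+ 2 / x = 0.
    by rewrite expr2 mulfK ?subrr// /x mulf_neq0 ?pnatr_eq0// gt_eqF.
  by rewrite mul0r mulr0 mul0r addr0 add0r.
by rewrite (holomorphic_sectional_curvature _ Tz).
Qed.

End Tube.

(** * Covectors with prescribed components *)

Lemma pos_form_unitmx (R : realType) (n : nat) (g : 'M[R]_n) :
  (forall e : 'rV[R]_n, e != 0 -> 0 < (e *m g *m e^T) 0 0) -> g \in unitmx.
Proof.
move=> gpos; rewrite -row_free_unit -kermx_eq0; apply/negPn/negP.
move=> /rowV0Pn[e]; rewrite sub_kermx => /eqP eg e0.
by have := gpos _ e0; rewrite eg mul0mx mxE ltxx.
Qed.

(** The transformation law of the inverse metric, which makes the norm of a covector independent of
    the chart. *)
Lemma invmx_congruence (R : realType) (n : nat) (J g : 'M[R]_n) :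
  J *m g *m J^T \in unitmx ->
  J^T *m invmx (J *m g *m J^T) *m J = invmx g.
Proof.
move=> U; have := U; rewrite !unitmx_mul => /andP[/andP[JU gU] JtU].
set G := J *m g *m J^T in U *.
have E : J^T *m invmx G *m J *m g = 1%:M.
  rewrite -[LHS](mulmxK JtU) -[_ *m J *m g]mulmxA -[_ *m (J *m g) *m J^T]mulmxA.
  by rewrite -/G (mulmxKV U) mulmxV.
by rewrite -[LHS](mulmxK gU) E mul1mx.
Qed.

Section CotangentVectors.
Context {R : realType} {n : nat} {T : topologicalType} {X : charted R T n}.
Hypothesis hM : is_smooth_manifold X.
Implicit Types (i j k : chart_index X) (x : T).

Lemma transitionE i j x : chart_dom i x -> chart_dom j x ->
  transition i j (chart_coord i x) = chart_coord j x.
Proof.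
move=> ix jx; rewrite /transition; case: xgetP => [v _ [y [iy jy yx <-]]|].
  by rewrite (chart_inj hM iy ix yx).
by move=> /(_ (chart_coord j x)); case; exists x.
Qed.

Lemma open_chart_range i : open (chart_range i).
Proof. by apply: (chart_open_map hM) => //; exact: (chart_dom_open hM). Qed.

Lemma open_overlap i j : open (overlap i j).
Proof.
apply: (chart_open_map hM); last by move=> x [].
by apply: openI; exact: (chart_dom_open hM).
Qed.

Lemma jac_transition_id i x : chart_dom i x ->
  jac (transition i i) (chart_coord i x) = 1%:M.
Proof.
move=> ix; apply/matrixP => a b; rewrite !mxE.
have Du : chart_range i (chart_coord i x) by exists x.
rewrite (@partial_eq_on _ _ _ _ (fun u => u 0 b) a _ (@open_chart_range i) Du).
  by rewrite partial_coord.
by move=> u; rewrite inE => -[y iy <-]; rewrite transitionE.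
Qed.

Lemma jac_transition_comp i j k x :
  chart_dom i x -> chart_dom j x -> chart_dom k x ->
  jac (transition i k) (chart_coord i x) =
  jac (transition i j) (chart_coord i x)
    *m jac (transition j k) (chart_coord j x).
Proof.
move=> ix jx kx; apply/matrixP => a b; rewrite !mxE.
(* On this open set [transition i k] is the composite of the two other transitions, so its
   derivatives are those of the composite. *)
pose W := chart_coord i @` (chart_dom i `&` (chart_dom j `&` chart_dom k)).
have oW : open W.
  apply: (chart_open_map hM); last by move=> y [].
  by do 2?[apply: openI]; exact: (chart_dom_open hM).
have Wx : W (chart_coord i x) by exists x.
have Ox : overlap j k (transition i j (chart_coord i x)).
  by rewrite transitionE//; exists x.
have Oij : overlap i j (chart_coord i x) by exists x.
rewrite (@partial_eq_on _ _ _ _ (fun u => transition j k (transition i j u) 0 b)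
  a _ oW Wx); last first.
  by move=> u; rewrite inE => -[y [iy [jy ky]] <-]; rewrite !transitionE.
have dij c : derivable (fun u => transition i j u 0 c) (chart_coord i x)
    (delta_mx 0 a).
  by apply: (smooth_on_derivable (transition_smooth hM i j c)).
have [_ ] := is_derive_chain (@open_overlap j k) Ox
  (transition_smooth hM j k b) dij.
rewrite /partial => ->; apply: eq_bigr => c _.
by rewrite !mxE /partial transitionE.
Qed.

(** The family of components determined by those in chart [i]; the value 0 in charts away from [x]
    is the one imposed by [cov_junk]. *)
Definition extend_covector i x (p : 'rV[R]_n) j : 'rV[R]_n :=
  if `[< chart_dom j x >]
  then p *m (jac (transition j i) (chart_coord j x))^T else 0.

Lemma extend_covector_change i x p : chart_dom i x -> forall j k,
  chart_dom j x -> chart_dom k x ->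
  extend_covector i x p j =
  extend_covector i x p k *m (jac (transition j k) (chart_coord j x))^T.
Proof.
move=> ix j k jx kx; rewrite /extend_covector !asboolT//.
by rewrite (jac_transition_comp jx kx ix) trmx_mul mulmxA.
Qed.

Lemma extend_covector_junk i x p j : ~ chart_dom j x ->
  extend_covector i x p j = 0.
Proof. by move=> jx; rewrite /extend_covector asboolF. Qed.

Definition covector_at i x (p : 'rV[R]_n) (ix : chart_dom i x) : covector X :=
  Covector (extend_covector_change p ix) (@extend_covector_junk i x p).

Lemma covector_at_comp i x p (ix : chart_dom i x) :
  cov_comp (covector_at p ix) i = p.
Proof.
by rewrite /= /extend_covector asboolT// jac_transition_id// trmx1 mulmx1.
Qed.

(** Membership in [tube] bounds the norm in every chart around the base point, so a bound checked in
    chart [i] has to be carried to the others. *)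
Lemma cov_sqnorm_covector_at (g : tensor_field2 X) i x p
    (ix : chart_dom i x) j :
  is_riemannian_metric g -> chart_dom j x ->
  cov_sqnorm (g j) (row_mx (chart_coord j x) (cov_comp (covector_at p ix) j)) =
  cov_sqnorm (g i) (row_mx (chart_coord i x) p).
Proof.
move=> hg jx; rewrite !cov_sqnormE !row_mxKl !row_mxKr /= /extend_covector.
rewrite asboolT//.
have Oji : overlap j i (chart_coord j x) by exists x.
have gjU : g j (chart_coord j x) \in unitmx.
  by apply: pos_form_unitmx; apply: (metric_pos hg); exists x.
have E := metric_change hg Oji; rewrite transitionE// in E.
rewrite E in gjU *; rewrite -(invmx_congruence gjU).
by rewrite trmx_mul trmxK !mulmxA.
Qed.

End CotangentVectors.

Theorem mainTheorem6 (R : realType) (n : nat) (M : topologicalType)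
    (X : charted R M n) (g : tensor_field2 X) (c A : R)
    (hn : (2 <= n)%N)
    (hM : is_smooth_manifold X)
    (M_nonempty : [set: M] !=set0)
    (hg : is_riemannian_metric g)
    (c_gt0 : 0 < c)
    (hc : has_constant_sectional_curvature g c)
    (A_gt0 : 0 < A) :
  ~ has_constant_holomorphic_sectional_curvature
      (tube g c A) (tube_metric g c A) (tube_complex_structure g c A).
Proof.
case: M_nonempty => x _ [k hk]; have [i ix] := chart_cover hM x.
have Du : chart_range i (chart_coord i x) by exists x.
have gU u : chart_range i u -> g i u \in unitmx.
  by move=> Du'; apply: pos_form_unitmx; exact: (metric_pos hg Du').
have gT := @Defs.metric_sym _ _ _ _ _ hg i.
have g_pos := @metric_pos _ _ _ _ _ hg i.
have sg : msmooth (chart_range i) (g i).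
  by move=> a b; exact: (metric_smooth hg).
have [p p_tube] : exists p,
    0 < cov_sqnorm (g i) (row_mx (chart_coord i x) p) < 4 * c / A ^+ 2.
  (* Any nonzero covector would do; [hn] reads [1 < n], so this is the second basis covector. *)
  pose e : 'rV[R]_n := delta_mx 0 (Ordinal hn).
  have e0 : e != 0.
    apply/eqP => /rowP /(_ (Ordinal hn)); rewrite !mxE !eqxx => /eqP.
    by rewrite oner_eq0.
  have := hq_pos gT gU g_pos (z := row_mx (chart_coord i x) 0) _ e0.
  rewrite row_mxKl => /(_ Du); set r := _ 0 0 => r0.
  (* Scaling by the square root of [s] gives the squared norm 2 c / A^2, the midpoint of the
     admissible interval. *)
  pose s := 2 * c / A ^+ 2 / r.
  have s0 : 0 < s by rewrite !divr_gt0 ?mulr_gt0 ?exprn_gt0.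
  exists (Num.sqrt s *: e); rewrite cov_sqnormE row_mxKl row_mxKr linearZ/=.
  rewrite -!(scalemxAl, scalemxAr) !mx11Z -/r mulrA -expr2 sqr_sqrtr ?ltW//.
  rewrite divfK ?gt_eqF// divr_gt0 ?mulr_gt0 ?exprn_gt0//=.
  by rewrite ltr_pM2r ?invr_gt0 ?exprn_gt0// ltr_pM2r// ltr_nat.
have xi_tube : tube g c A (covector_at hM p ix).
  by move=> j jx; rewrite /= cov_sqnorm_covector_at.
have zE : chart_coord (c := cotangent X) i (covector_at hM p ix) =
    row_mx (chart_coord i x) p.
  rewrite -[LHS]/(row_mx (chart_coord i x) (cov_comp (covector_at hM p ix) i)).
  by rewrite covector_at_comp.
have zT : tube_dom (chart_range i) (g i) c A (row_mx (chart_coord i x) p).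
  by split=> //; rewrite row_mxKl.
apply: (holomorphic_curvature_not_constant (open_chart_range hM (i := i))
  sg gT gU c_gt0 A_gt0 g_pos _ (k := k) zT hn).
  by move=> u [y iy <-] e e'; exact: hc.
move=> v v0; have := hk i (covector_at hM p ix) ix xi_tube v v0.
by rewrite zE.
Qed.
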